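(* Let $f:\mathcal M\to\mathbb{R}^n$ be a mapping whose tangential gradient $\nabla_{\mathcal M}f$ is Lipschitz-continuous on $\mathcal M$. Then $$\big|\mathcal E_D(f)-\mathcal E_D^h(f)\big|\le\varepsilon_D^h(f)=\frac12\int_{\mathcal M}\psi_f^2(\mathbf{x})\,d\sigma+\sqrt{2\,\mathcal E_D^h(f)\int_{\mathcal M}\psi_f^2(\mathbf{x})\,d\sigma}.$$
   Context: $\mathcal M$ is a smooth simple surface embedded in $\mathbb{R}^m$ with $m\ge2$, parameterized as $\mathcal M=\{\mathbf{x}(\omega):\omega\in\Omega\}$, $\Omega\subset\mathbb{R}^2$, with $\nabla\mathbf{x}(\omega)\in\mathbb{R}^{m\times2}$ the matrix of partial derivatives, of full column rank. $\Omega$ is partitioned, without overlaps, into finitely many nondegenerate triangles $\Omega_{ijk}$ with vertices $\omega_i,\omega_j,\omega_k$; $\mathcal M_{ijk}=\{\mathbf{x}(\omega):\omega\in\Omega_{ijk}\}$, so $\mathcal M=\bigcup\mathcal M_{ijk}$ without overlaps. $v_\ell=\mathbf{x}(\omega_\ell)$; $V_{ijk}$ is the triangle with vertices $v_i,v_j,v_k$, assumed nondegenerate, with area $A_{ijk}$; $v_{ij}=v_i-v_j$, $v_{jk}=v_j-v_k$, $v_{ki}=v_k-v_i$. $\mathbf{n}_{ijk}$ is the unit normal vector of the plane of $V_{ijk}$ in a right-hand system, with $v_{ij}\times v_{jk}=2A_{ijk}\mathbf{n}_{ijk}$, where $\times$ is the exterior (cross) product. Set $b_i=\frac{v_{jk}\times\mathbf{n}_{ijk}}{2A_{ijk}}$,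 $b_j=\frac{v_{ki}\times\mathbf{n}_{ijk}}{2A_{ijk}}$, $b_k=\frac{v_{ij}\times\mathbf{n}_{ijk}}{2A_{ijk}}$ and $b_{ijk}=[b_i,b_j,b_k]\in\mathbb{R}^{m\times3}$; thus the barycentric coordinates of a point $p$ of the plane of $V_{ijk}$ are $\langle b_i,p-v_j\rangle$, $\langle b_j,p-v_k\rangle$, $\langle b_k,p-v_i\rangle$, and $b_{ijk}^\top\mathbf{n}_{ijk}=0$. $Q(\mathbf{x})=\nabla\mathbf{x}(\nabla\mathbf{x}^\top\nabla\mathbf{x})^{-1/2}$. The tangential gradient is $\nabla_{\mathcal M}f(\mathbf{x})=\nabla(f\circ\mathbf{x})\,(\nabla\mathbf{x}^\top\nabla\mathbf{x})^{-1}\nabla\mathbf{x}^\top\in\mathbb{R}^{n\times m}$, where $\nabla(f\circ\mathbf{x})\in\mathbb{R}^{n\times2}$ is the Jacobian of $\omega\mapsto f(\mathbf{x}(\omega))$. Put $f_{ijk}=[f(v_i),f(v_j),f(v_k)]$, $h_{ijk}(\mathbf{x})=[h_i(\mathbf{x}),h_j(\mathbf{x}),h_k(\mathbf{x})]$ with $h_\ell(\mathbf{x})=f(v_\ell)-f(\mathbf{x})+\nabla_{\mathcal M}f(\mathbf{x})(\mathbf{x}-v_\ell)$, and, for $\mathbf{x}\in\mathcal M_{ijk}$, $$\psi_f(\mathbf{x})=\|h_{ijk}(\mathbf{x})b_{ijk}^\top\|_F+\|\nabla_{\mathcal M}f(\mathbf{x})\|_F\,\|\mathbf{n}_{ijk}^\top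 Q(\mathbf{x})\|_2^2 .$$ The continuous and discrete Dirichlet energies are $$\mathcal E_D(f)=\frac12\int_{\mathcal M}\|\nabla_{\mathcal M}f(\mathbf{x})\|_F^2\,d\sigma,\qquad \mathcal E_D^h(f)=\sum_{\mathcal M_{ijk}}\frac12\int_{\mathcal M_{ijk}}\|f_{ijk}b_{ijk}^\top\|_F^2\,d\sigma,$$ with $d\sigma$ the surface area element. $\|\cdot\|_F$ is the Frobenius norm, $\|\cdot\|_2$ the Euclidean norm. *)

(* Defs.v *)
From HB Require Import structures.
From mathcomp Require Import all_boot all_order all_algebra.
From mathcomp Require Import all_classical all_reals all_analysis.
From mathcomp Require Import zify ring lra.
Set Implicit Arguments.
Unset Strict Implicit.
Unset Printing Implicit Defensive.
Import Order.TTheory GRing.Theory Num.Theory.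
Import numFieldNormedType.Exports.
Local Open Scope classical_set_scope.
Local Open Scope ring_scope.

Section LinearAlgebra.
Context {R : realType}.

Definition frob p q (A : 'M[R]_(p, q)) : R :=
  Num.sqrt (\sum_i \sum_j A i j ^+ 2).

(* The matrix norm induced by the Euclidean norm; on a single row it is the
   Euclidean norm of that row, see [norm2_row]. *)
Definition norm2 p q (A : 'M[R]_(p, q)) : R :=
  sup [set frob (A *m y) | y in [set y : 'cV[R]_q | frob y <= 1]].

Definition cols3 p (a b c : 'cV[R]_p) : 'M[R]_(p, 3) :=
  row_mx a (row_mx b c).

Definition dotv p (u v : 'cV[R]_p) : R := (u^T *m v) 0 0.

Definition posdefmx p (A : 'M[R]_p) : Prop :=
  A^T = A /\ forall y : 'cV[R]_p, y != 0 -> 0 < (y^T *m A *m y) 0 0.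

Definition sqrtmx p (A : 'M[R]_p) : 'M[R]_p :=
  xget 0 [set S | posdefmx S /\ S *m S = A].

(* Exterior algebra of R^m for an arbitrary m.  The 2-vector u /\ v is the
   skew-symmetric matrix of its coordinates.  For m = 3 a 2-vector N is
   identified with the vector (N 1 2, N 2 0, N 0 1), and u /\ v with u x v. *)
Definition extmul m (u v : 'cV[R]_m) : 'M[R]_m := u *m v^T - v *m u^T.

(* Product v x N of a vector and a 2-vector: the contraction, which for m = 3
   is the cross product with the vector N, see [mulv2_cross3]. *)
Definition mulv2 m (v : 'cV[R]_m) (N : 'M[R]_m) : 'cV[R]_m := N *m v.

Definition incr3 m : {set 'I_m * 'I_m * 'I_m} :=
  [set t : 'I_m * 'I_m * 'I_m | (t.1.1 < t.1.2 < t.2)%N]%SET.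

(* N^T Q for a 2-vector N: column j holds the coordinates, indexed by a < b < c,
   of the 3-vector N /\ q_j, with q_j the j-th column of Q.  For m = 3 there is
   a single coordinate, the inner product <N, q_j>, see [dot2_cross3]; for m = 2
   there is none, and N^T Q is null, N being normal to the ambient plane. *)
Definition dot2 m q (N : 'M[R]_m) (Q : 'M[R]_(m, q)) : 'M[R]_(#|incr3 m|, q) :=
  \matrix_(r, j) let: (a, b, c) := enum_val r in
    N a b * Q c j + N b c * Q a j + N c a * Q b j.

End LinearAlgebra.

Section Surface.
Context {R : realType}.
Local Notation plane := (R * R)%type.

Definition pt (w : plane) : 'cV[R]_2 :=
  \col_(i < 2) (if i == 0 then w.1 else w.2).

Fixpoint class_C (k : nat) (U : set plane) m (g : plane -> 'cV[R]_m) : Prop :=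
  match k with
  | 0 => forall w, U w -> {for w, continuous g}
  | k'.+1 => forall v : plane,
      (forall w, U w -> derivable g w v) /\ class_C k' U (fun w => 'D_v g w)
  end.

Definition grad m (x : plane -> 'cV[R]_m) (w : plane) : 'M[R]_(m, 2) :=
  row_mx ('D_((1, 0) : plane) x w) ('D_((0, 1) : plane) x w).

Definition smooth_simple_surface m (Omega : set plane) (x : plane -> 'cV[R]_m) :=
  [/\ exists2 U : set plane, open U /\ Omega `<=` U & forall k, class_C k U x,
      {in Omega &, injective x}
    & forall w, Omega w -> \rank (grad x w) = 2%N].

(* Jacobian of a map known only on Omega, boundary points included: the
   first-order expansion is required along points of Omega. *)
Definition is_jacobian_on (Omega : set plane) n (g : plane -> 'cV[R]_n)
    (w : plane) (J : 'M[R]_(n, 2)) : Prop :=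
  forall e : R, 0 < e -> \forall w' \near within Omega (nbhs w),
    frob (g w' - g w - J *m pt (w' - w)) <= e * frob (pt (w' - w)).

Definition jacobian_on (Omega : set plane) n (g : plane -> 'cV[R]_n)
    (w : plane) : 'M[R]_(n, 2) :=
  xget 0 [set J | is_jacobian_on Omega g w J].

Definition triangle (a b c : plane) : set plane :=
  [set p | exists s t u : R, [/\ 0 <= s, 0 <= t, 0 <= u, s + t + u = 1
    & p = s *: a + t *: b + u *: c]].

Definition tri_of N (omega : 'I_N -> plane) (t : 'I_N * 'I_N * 'I_N) :=
  triangle (omega t.1.1) (omega t.1.2) (omega t.2).

Definition nondegenerate (a b c : plane) : Prop :=
  (a - b).1 * (b - c).2 - (a - b).2 * (b - c).1 != 0.

Definition triangulation N (Omega : set plane) (omega : 'I_N -> plane)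
    (S : {set 'I_N * 'I_N * 'I_N}) : Prop :=
  [/\ forall t, t \in S -> nondegenerate (omega t.1.1) (omega t.1.2) (omega t.2),
      Omega = \bigcup_(t in [set` S]) tri_of omega t
    & forall t t', t \in S -> t' \in S -> t != t' ->
        interior (tri_of omega t) `&` interior (tri_of omega t') = set0].

Section Triangle.
Context {m : nat} (vi vj vk : 'cV[R]_m).

Definition area : R :=
  Num.sqrt (dotv (vi - vj) (vi - vj) * dotv (vj - vk) (vj - vk)
            - dotv (vi - vj) (vj - vk) ^+ 2) / 2.

(* The unit 2-vector n with v_ij x v_jk = 2 A n. *)
Definition normal2 : 'M[R]_m := (2 * area)^-1 *: extmul (vi - vj) (vj - vk).

Definition bmx : 'M[R]_(m, 3) := (2 * area)^-1 *:
  cols3 (mulv2 (vj - vk) normal2) (mulv2 (vk - vi) normal2)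
        (mulv2 (vi - vj) normal2).

End Triangle.

Section Energies.
Context {m n N : nat} (Omega : set plane) (x : plane -> 'cV[R]_m)
  (omega : 'I_N -> plane) (S : {set 'I_N * 'I_N * 'I_N})
  (f : 'cV[R]_m -> 'cV[R]_n).

Definition gram (w : plane) : 'M[R]_2 := (grad x w)^T *m grad x w.

Definition Qmx (w : plane) : 'M[R]_(m, 2) :=
  grad x w *m invmx (sqrtmx (gram w)).

(* Functions on the surface are given in the parameter w, at the point x w. *)
Definition tgrad (w : plane) : 'M[R]_(n, m) :=
  jacobian_on Omega (f \o x) w *m invmx (gram w) *m (grad x w)^T.

Definition has_lipschitz_tgrad : Prop :=
  (forall w, Omega w -> exists J, is_jacobian_on Omega (f \o x) w J) /\
  exists L : R, forall w w', Omega w -> Omega w' ->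
    frob (tgrad w - tgrad w') <= L * frob (x w - x w').

Definition leb2 := ((@lebesgue_measure R) \x (@lebesgue_measure R))%E.

Definition surf_int (D : set plane) (g : plane -> R) : R :=
  \int[leb2]_(w in D) (g w * Num.sqrt (\det (gram w))).

Definition vtx (l : 'I_N) : 'cV[R]_m := x (omega l).

Definition tarea (t : 'I_N * 'I_N * 'I_N) : R :=
  area (vtx t.1.1) (vtx t.1.2) (vtx t.2).

Definition tnormal (t : 'I_N * 'I_N * 'I_N) : 'M[R]_m :=
  normal2 (vtx t.1.1) (vtx t.1.2) (vtx t.2).

Definition tbmx (t : 'I_N * 'I_N * 'I_N) : 'M[R]_(m, 3) :=
  bmx (vtx t.1.1) (vtx t.1.2) (vtx t.2).

Definition tfmx (t : 'I_N * 'I_N * 'I_N) : 'M[R]_(n, 3) :=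
  cols3 (f (vtx t.1.1)) (f (vtx t.1.2)) (f (vtx t.2)).

Definition hvec (l : 'I_N) (w : plane) : 'cV[R]_n :=
  f (vtx l) - f (x w) + tgrad w *m (x w - vtx l).

Definition thmx (t : 'I_N * 'I_N * 'I_N) (w : plane) : 'M[R]_(n, 3) :=
  cols3 (hvec t.1.1 w) (hvec t.1.2 w) (hvec t.2 w).

(* On the edges shared by several triangles, which form a null set, one of
   these triangles is selected. *)
Definition psi (w : plane) : R :=
  if [pick t in S | w \in tri_of omega t] is Some t then
    frob (thmx t w *m (tbmx t)^T)
    + frob (tgrad w) * norm2 (dot2 (tnormal t) (Qmx w)) ^+ 2
  else 0.

Definition dirichlet : R :=
  1 / 2 * surf_int Omega (fun w => frob (tgrad w) ^+ 2).

Definition discrete_dirichlet : R :=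
  \sum_(t in S) 1 / 2 *
    surf_int (tri_of omega t) (fun=> frob (tfmx t *m (tbmx t)^T) ^+ 2).

End Energies.
End Surface.

Section ThreeDimensionalCase.
Context {R : realType}.
Implicit Types (u w a : 'cV[R]_3).

Definition cross3 u w : 'cV[R]_3 := \col_(i < 3)
  (u (i + 1) 0 * w (i + 2) 0 - u (i + 2) 0 * w (i + 1) 0).

Lemma mulv2_cross3 u w a : mulv2 a (extmul u w) = cross3 a (cross3 u w).
Proof.
have E p (B : 'M[R]_(3, p)) :
    exists F : nat -> 'I_p -> R, forall k l, B k l = F k l.
  by exists (fun k => B (inord k)) => k l; rewrite inord_val.
apply/matrixP => i j; rewrite (ord1 j) /mulv2 /extmul !mxE.
rewrite !big_ord_recl big_ord0 !mxE !big_ord1 !mxE.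
move: (E _ u) (E _ w) (E _ a) => [U uE] [W wE] [A aE]; rewrite !uE !wE !aE.
by case: i => [[|[|[|]]]] //= ?; rewrite /bump /=; ring.
Qed.

Lemma dot2_cross3 q u w (Q : 'M[R]_(3, q)) r j :
  dot2 (extmul u w) Q r j = ((cross3 u w)^T *m Q) 0 j.
Proof.
have E p (B : 'M[R]_(3, p)) :
    exists F : nat -> 'I_p -> R, forall k l, B k l = F k l.
  by exists (fun k => B (inord k)) => k l; rewrite inord_val.
rewrite /dot2 mxE; have := enum_valP r.
case: (enum_val r) => -[a b] c; rewrite inE /= => /andP[ab bc].
have [a0 b1 c2] : [/\ a = 0, b = 1 & c = 2].
  case: a b c ab bc => [a ?] [b ?] [c ?] /= ab bc.
  by split; apply/val_inj => /=; lia.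
rewrite a0 b1 c2 /extmul !mxE !big_ord1 !big_ord_recl big_ord0 !mxE.
move: (E _ u) (E _ w) (E _ Q) => [U uE] [W wE] [A aE]; rewrite !uE !wE !aE.
by rewrite /bump /=; ring.
Qed.

Lemma norm2_row q (A : 'rV[R]_q) : norm2 A = frob A.
Proof.
have frob0 p s : frob (0 : 'M[R]_(p, s)) = 0.
  by rewrite /frob big1 ?sqrtr0// => i _; rewrite big1// => k _; rewrite mxE expr0n.
have sq p s (B : 'M[R]_(p, s)) : frob B ^+ 2 = \sum_i \sum_j B i j ^+ 2.
  by rewrite sqr_sqrtr// sumr_ge0// => i _; rewrite sumr_ge0// => k _; rewrite sqr_ge0.
have ge0 p s (B : 'M[R]_(p, s)) : 0 <= frob B by exact: sqrtr_ge0.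
have f11 (B : 'M[R]_1) : frob B = `|B 0 0| by rewrite /frob !big_ord1 sqrtr_sqr.
have ub (y : 'cV[R]_q) : frob y <= 1 -> frob (A *m y) <= frob A.
  move=> y1; suff: frob (A *m y) ^+ 2 <= frob A ^+ 2.
    by rewrite ler_pXn2r ?nnegrE ?ge0.
  rewrite f11 real_normK ?num_real//.
  set s := (A *m y) 0 0.
  have : 0 <= \sum_k (A 0 k - s * y k 0) ^+ 2 by rewrite sumr_ge0// => k _; rewrite sqr_ge0.
  have -> : \sum_k (A 0 k - s * y k 0) ^+ 2
      = frob A ^+ 2 - (s * s) *+ 2 + s ^+ 2 * frob y ^+ 2.
    rewrite !sq big_ord1 {3}/s mxE mulr_sumr -sumrMnl -sumrN -big_split/= mulr_sumr.
    rewrite -big_split/=; apply: eq_bigr => k _; rewrite big_ord1; ring.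
  have : s ^+ 2 * frob y ^+ 2 <= s ^+ 2.
    by rewrite ler_piMr ?sqr_ge0// expr_le1.
  lra.
apply/eqP; rewrite eq_le; apply/andP; split.
  apply: ge_sup; last by move=> _ [y y1 <-]; exact: ub.
  by exists (frob (A *m (0 : 'cV_q))), 0 => //=; rewrite frob0.
have [A0|A0] := eqVneq (frob A) 0.
  rewrite A0; apply: ub_le_sup.
    by exists (frob A) => _ [y y1 <-]; exact: ub.
  by exists 0; rewrite /= ?mulmx0 ?frob0.
apply: ub_le_sup; first by exists (frob A) => _ [y y1 <-]; exact: ub.
exists ((frob A)^-1 *: A^T).
  suff: frob ((frob A)^-1 *: A^T) ^+ 2 <= 1 by rewrite expr_le1// ge0.
  rewrite sq.
  under eq_bigr do rewrite big_ord1 !mxE exprMn.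
  rewrite -mulr_sumr; have := sq _ _ A; rewrite big_ord1 => <-.
  by rewrite -exprMn mulVf// expr1n.
rewrite f11 -scalemxAr !mxE.
under eq_bigr do rewrite mxE -expr2.
have := sq _ _ A; rewrite big_ord1 => <-.
by rewrite expr2 mulrA mulVf// mul1r ger0_norm.
Qed.

End ThreeDimensionalCase.

(* Main.v *)
Require Import Defs.
From HB Require Import structures.
From mathcomp Require Import all_boot all_order all_algebra.
From mathcomp Require Import all_classical all_reals all_analysis.
From mathcomp Require Import measurable_realfun.
From mathcomp Require Import zify ring lra.
Set Implicit Arguments.
Unset Strict Implicit.
Unset Printing Implicit Defensive.
Import Order.TTheory GRing.Theory Num.Theory.
Import numFieldNormedType.Exports.
Local Open Scope classical_set_scope.
Local Open Scope ring_scope.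

(** Fix a triangle with vertices [v_i, v_j, v_k], unit normal 2-vector [N] and
    barycentric gradients [b].  For a 2-vector of unit length, [P = N N^T] is the
    orthogonal projection onto its plane, and barycentric coordinates reproduce
    affine maps, that is [[v_i, v_j, v_k] b^T = P] and [1^T b^T = 0]
    ([mul_bmx_vertices], [mul_bmx_const]).  Multiplying the definition of the
    remainders [h] by [b^T] therefore gives [h b^T = f b^T - (grad f) P]
    ([thmx_bmx]), so that [|f b^T|] is within [|h b^T|] of [|(grad f) P|].

    It remains to compare [|(grad f) P|] with [|grad f|].  The tangential gradient
    is [G Q^T], where [Q] has orthonormal columns ([polar_orthonormal],
    [polar_tangent]).  By Pythagoras [|G Q^T|^2 - |G Q^T P|^2] is the squared
    norm of the part of [Q G^T] normal to the plane of [N]; as [|N /\ q|] is the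
    length of the normal part of [q] ([frob_dot2]), it is at most
    [s^2 |grad f|^2] with [s] the norm of [N^T Q].  The difference of the squares
    being quadratic in [s], so is that of the norms ([norm_defect_proj]).  Hence
    [| |grad f| - |f b^T| | <= psi] at every point ([dist_frob_le_psi]).

    With [a = |grad f|] and [c = |f b^T|], the identity
    [a^2 - c^2 = (a - c)^2 + 2 c (a - c)] yields [|a^2 - c^2| <= psi^2 + 2 c psi].
    Integrating and estimating the integral of [c psi] by Cauchy-Schwarz, over all
    triangles at once, gives the theorem ([energy_gap]).

    The integrals involved are finite because every integrand is continuous on
    each closed triangle of the parameter domain, which is compact
    ([compact_integrable]).  For [psi] this needs the continuity of the inverse
    square root of the metric, read off from the closed formula that
    Cayley-Hamilton provides for [2 x 2] matrices ([sqrtmxE]).  The triangles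
    overlap only along edges, which lie on lines and are null
    ([triangle_overlap_negligible]), so integrals over the surface are sums over
    the triangles ([Rintegral_pick]). *)

(** * Frobenius and operator norms *)

Section FrobeniusNorm.
Context {R : realType}.

(** The discriminant argument common to the Cauchy-Schwarz inequalities for
    matrices and for energies. *)
Lemma sqr_le_of_quadratic_ge0 (B M P : R) : 0 <= P ->
  (forall l, 0 <= B - 2 * l * M + l ^+ 2 * P) -> M ^+ 2 <= B * P.
Proof.
move=> P0 H; have [P00|Pn0] := eqVneq P 0.
  have [->|M0] := eqVneq M 0; first by rewrite expr0n P00 mulr0.
  (* the polynomial is affine and takes the value -1 at this point *)
  have := H ((B + 1) / (2 * M)); rewrite P00 mulr0 addr0.
  have -> : B - 2 * ((B + 1) / (2 * M)) * M = -1 by field.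
  by lra.
have Pgt0 : 0 < P by rewrite lt0r Pn0.
(* the minimum of the parabola *)
have := H (M / P).
have -> : B - 2 * (M / P) * M + (M / P) ^+ 2 * P = (B * P - M ^+ 2) / P by field.
by rewrite pmulr_lge0 ?invr_gt0// subr_ge0.
Qed.

Lemma frob_ge0 p q (A : 'M[R]_(p, q)) : 0 <= frob A.
Proof. exact: sqrtr_ge0. Qed.

Lemma frob_sqr p q (A : 'M[R]_(p, q)) : frob A ^+ 2 = \sum_i \sum_j A i j ^+ 2.
Proof. by rewrite sqr_sqrtr// !sumr_ge0// => *; rewrite sumr_ge0// => *; rewrite sqr_ge0. Qed.

Lemma frob_sqr_tr p q (A : 'M[R]_(p, q)) : frob A ^+ 2 = \tr (A *m A^T).
Proof.
rewrite frob_sqr; apply: eq_bigr => i _; rewrite mxE.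
by apply: eq_bigr => j _; rewrite mxE expr2.
Qed.

Lemma frob_trmx p q (A : 'M[R]_(p, q)) : frob A^T = frob A.
Proof.
congr Num.sqrt; rewrite exchange_big; apply: eq_bigr => i _.
by apply: eq_bigr => j _; rewrite mxE.
Qed.

Lemma frob0 p q : frob (0 : 'M[R]_(p, q)) = 0.
Proof. by rewrite /frob !big1 ?sqrtr0// => i _; rewrite big1// => j _; rewrite mxE expr0n. Qed.

Lemma frobZ p q (a : R) (A : 'M[R]_(p, q)) : frob (a *: A) = `|a| * frob A.
Proof.
rewrite -sqrtr_sqr -sqrtrM ?sqr_ge0//; congr Num.sqrt; rewrite mulr_sumr.
apply: eq_bigr => i _; rewrite mulr_sumr.
by apply: eq_bigr => j _; rewrite mxE exprMn.
Qed.

Lemma frobN p q (A : 'M[R]_(p, q)) : frob (- A) = frob A.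
Proof. by rewrite -scaleN1r frobZ normrN1 mul1r. Qed.

Lemma frob_sqrD p q (A B : 'M[R]_(p, q)) :
  frob (A + B) ^+ 2 = frob A ^+ 2 + 2 * \tr (A *m B^T) + frob B ^+ 2.
Proof.
rewrite !frob_sqr_tr linearD /= mulmxDl !mulmxDr !mxtraceD.
have -> : \tr (B *m A^T) = \tr (A *m B^T) by rewrite -mxtrace_tr trmx_mul trmxK.
by ring.
Qed.

Lemma frob_cauchy p q (A B : 'M[R]_(p, q)) : `|\tr (A *m B^T)| <= frob A * frob B.
Proof.
rewrite -ler_sqr ?nnegrE ?mulr_ge0 ?frob_ge0 ?normr_ge0// exprMn.
rewrite real_normK ?num_real//; apply: sqr_le_of_quadratic_ge0 => [|l].
  exact: sqr_ge0.
have := sqr_ge0 (frob (A + (- l) *: B)).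
rewrite frob_sqrD frobZ exprMn real_normK ?num_real// linearZ/= -scalemxAr mxtraceZ.
by rewrite sqrrN; congr (_ <= _); ring.
Qed.

Lemma ler_frobD p q (A B : 'M[R]_(p, q)) : frob (A + B) <= frob A + frob B.
Proof.
rewrite -ler_sqr ?nnegrE ?addr_ge0 ?frob_ge0// frob_sqrD.
have := frob_cauchy A B; have := ler_norm (\tr (A *m B^T)).
lra.
Qed.

Lemma ler_dist_frob p q (A B : 'M[R]_(p, q)) : `|frob A - frob B| <= frob (A - B).
Proof.
rewrite ler_norml; have := ler_frobD (A - B) B; have := ler_frobD (B - A) A.
rewrite !subrK -(opprB A B) frobN; lra.
Qed.

Lemma ler_entry_frob p q (A : 'M[R]_(p, q)) i j : `|A i j| <= frob A.
Proof.
rewrite -ler_sqr ?nnegrE ?frob_ge0// real_normK ?num_real// frob_sqr.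
rewrite (bigD1 i)//= (bigD1 j)//= -addrA lerDl addr_ge0 ?sumr_ge0// => k _.
  exact: sqr_ge0.
by rewrite sumr_ge0// => l _; exact: sqr_ge0.
Qed.

(** Cauchy-Schwarz for each entry of the product, a row times a column. *)
Lemma frob_mulmx p q r (A : 'M[R]_(p, q)) (B : 'M[R]_(q, r)) :
  frob (A *m B) <= frob A * frob B.
Proof.
rewrite -ler_sqr ?nnegrE ?mulr_ge0 ?frob_ge0// exprMn !frob_sqr.
rewrite mulr_suml; apply: ler_sum => i _.
rewrite [X in _ * X]exchange_big mulr_sumr; apply: ler_sum => k _ /=.
have := lerXn2r 2 (normr_ge0 _) (mulr_ge0 (frob_ge0 _) (frob_ge0 _))
  (frob_cauchy (row i A) (col k B)^T).
rewrite exprMn trmxK real_normK ?num_real// frob_trmx !frob_sqr big_ord1.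
congr (_ ^+ 2 <= _ * _).
- by rewrite /mxtrace big_ord1 !mxE; apply: eq_bigr => j _; rewrite !mxE.
- by apply: eq_bigr => j _; rewrite mxE.
- by apply: eq_bigr => j _; rewrite big_ord1 mxE.
Qed.

(** The set of values whose supremum is [norm2 A] is bounded, since the Frobenius
    norm is submultiplicative; without this [sup] would be a default value. *)
Lemma norm2_bound p q (A : 'M[R]_(p, q)) (y : 'cV[R]_q) :
  frob (A *m y) <= norm2 A * frob y.
Proof.
have bnd : has_ubound [set frob (A *m y) | y in [set y : 'cV[R]_q | frob y <= 1]].
  exists (frob A) => _ [z /= z1 <-]; apply: le_trans (frob_mulmx _ _) _.
  by rewrite ler_piMr ?frob_ge0.
have [y0|yn0] := eqVneq (frob y) 0.
  by rewrite y0 mulr0; have := frob_mulmx A y; rewrite y0 mulr0.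
rewrite -ler_pdivrMr ?lt0r ?yn0 ?frob_ge0//.
apply: ub_le_sup => //; exists ((frob y)^-1 *: y) => /=.
  by rewrite frobZ ger0_norm ?invr_ge0 ?frob_ge0// mulVf.
by rewrite -scalemxAr frobZ ger0_norm ?invr_ge0 ?frob_ge0// mulrC.
Qed.

Lemma norm2_le p q (A : 'M[R]_(p, q)) (c : R) :
  (forall y : 'cV[R]_q, frob y <= 1 -> frob (A *m y) <= c) -> norm2 A <= c.
Proof.
move=> H; apply: ge_sup; last by move=> _ [y y1 <-]; exact: H.
by exists (frob (A *m (0 : 'cV_q))), 0 => //=; rewrite frob0.
Qed.

Lemma norm2_ge0 p q (A : 'M[R]_(p, q)) : 0 <= norm2 A.
Proof.
apply: ub_le_sup; last by exists 0; rewrite /= ?mulmx0 ?frob0.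
exists (frob A) => _ [z /= z1 <-]; apply: le_trans (frob_mulmx _ _) _.
by rewrite ler_piMr ?frob_ge0.
Qed.

(** The Lipschitz bound from which the continuity of the operator norm follows. *)
Lemma ler_dist_norm2 p q (A B : 'M[R]_(p, q)) : `|norm2 A - norm2 B| <= frob (A - B).
Proof.
have le (C D : 'M[R]_(p, q)) : norm2 C <= norm2 D + frob (C - D).
  apply: norm2_le => y y1; rewrite -{1}[C](subrK D) addrC mulmxDl.
  apply: le_trans (ler_frobD _ _) _; apply: lerD.
    apply: le_trans (norm2_bound _ _) _.
    by rewrite ler_piMr ?norm2_ge0.
  apply: le_trans (frob_mulmx _ _) _.
  by rewrite ler_piMr ?frob_ge0.
by rewrite ler_norml; have := le A B; have := le B A; rewrite -(opprB A B) frobN; lra.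
Qed.

End FrobeniusNorm.

(** * Simple 2-vectors and their norms *)

Section TrianglePlane.
Context {R : realType} {m : nat}.
Implicit Types (u v q : 'cV[R]_m) (N : 'M[R]_m).

Lemma dotvC u v : dotv u v = dotv v u.
Proof. by rewrite /dotv -[u^T *m v]trmxK trmx_mul trmxK mxE. Qed.

Lemma mulmx_dotv p (w : 'M[R]_(p, 1)) u v : w *m (u^T *m v) = dotv u v *: w.
Proof. by rewrite [u^T *m v]mx11_scalar mul_mx_scalar. Qed.

Lemma extmul_mul u v w : extmul u v *m w = dotv v w *: u - dotv u w *: v.
Proof. by rewrite /extmul mulmxBl -!mulmxA !mulmx_dotv. Qed.

Lemma tr_extmul u v : (extmul u v)^T = - extmul u v.
Proof. by rewrite /extmul linearB /= !trmx_mul !trmxK opprB. Qed.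

(** On the plane of [u] and [v] the matrix [N] is a quarter turn up to scaling, its
    square being minus the Gram determinant, and its range lies in that plane. *)
Lemma extmul_cube u v (N := extmul u v) :
  N *m (N *m N) = (dotv u v ^+ 2 - dotv u u * dotv v v) *: N.
Proof.
have Nu : N *m (N *m u) = (dotv u v ^+ 2 - dotv u u * dotv v v) *: u.
  rewrite /N (extmul_mul u v u) mulmxBr -!scalemxAr !extmul_mul (dotvC v u).
  by apply/colP => i; rewrite !mxE; ring.
have Nv : N *m (N *m v) = (dotv u v ^+ 2 - dotv u u * dotv v v) *: v.
  rewrite /N (extmul_mul u v v) mulmxBr -!scalemxAr !extmul_mul (dotvC v u).
  by apply/colP => i; rewrite !mxE; ring.
rewrite {3}/N /extmul !mulmxBr !mulmxA -(mulmxA N N u) -(mulmxA N N v) Nu Nv.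
by rewrite -!scalemxAl scalerBr.
Qed.

Lemma extmul_frob u v :
  frob (extmul u v) ^+ 2 = 2 * (dotv u u * dotv v v - dotv u v ^+ 2).
Proof.
rewrite frob_sqr_tr tr_extmul mulmxN {2}/extmul mulmxBr !mulmxA !extmul_mul.
rewrite !mulmxBl -!scalemxAl raddfN /= !raddfB /= !mxtraceZ.
have tr w z : \tr (w *m z^T) = dotv z w by rewrite mxtrace_mulC trace_mx11.
by rewrite !tr (dotvC v u); ring.
Qed.

Section SumsOverTriples.
Variable I : 'I_m -> 'I_m -> 'I_m -> R.
Local Notation s := (\sum_a \sum_b \sum_c I a b c).

Lemma sum3_132 : \sum_a \sum_b \sum_c I a c b = s.
Proof. by apply: eq_bigr => a _; rewrite exchange_big. Qed.

Lemma sum3_213 : \sum_a \sum_b \sum_c I b a c = s.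
Proof. by rewrite exchange_big. Qed.

Lemma sum3_231 : \sum_a \sum_b \sum_c I b c a = s.
Proof. by rewrite exchange_big -sum3_132. Qed.

Lemma sum3_312 : \sum_a \sum_b \sum_c I c a b = s.
Proof. by rewrite -sum3_213; apply: eq_bigr => a _; rewrite exchange_big. Qed.

Lemma sum3_321 : \sum_a \sum_b \sum_c I c b a = s.
Proof. by rewrite -sum3_231; apply: eq_bigr => a _; rewrite exchange_big. Qed.

End SumsOverTriples.

(** A triple of distinct indices is a rearrangement of exactly one increasing
    triple; the triples with a repeated index contribute nothing. *)
Lemma sum_incr3 (g : 'I_m -> 'I_m -> 'I_m -> R) :
    (forall a b c, g a b c = g b a c) -> (forall a b c, g a b c = g a c b) ->
    (forall a c, g a a c = 0) ->
  \sum_a \sum_b \sum_c g a b c = 6 * \sum_(t in incr3 m) g t.1.1 t.1.2 t.2.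
Proof.
move=> g12 g23 g0; pose I (a b c : 'I_m) := if (a < b < c)%N then g a b c else 0.
have gI a b c : g a b c = I a b c + I a c b + I b a c + I b c a + I c a b + I c b a.
  have g1 : g b a c = g a b c by rewrite g12.
  have g2 : g a c b = g a b c by rewrite g23.
  have g3 : g b c a = g a b c by rewrite g23 g1.
  have g4 : g c a b = g a b c by rewrite g12 g2.
  have g5 : g c b a = g a b c by rewrite g12 g3.
  have g0' : g a b b = 0 by rewrite g12 g23 g0.
  have g0'' : g a b a = 0 by rewrite g23 g0.
  rewrite /I g1 g2 g3 g4 g5.
  case: (ltngtP a b) => [ab|ab|/val_inj ab]; case: (ltngtP b c) => [bc|bc|/val_inj bc];
   case: (ltngtP a c) => [ac|ac|/val_inj ac] /=; rewrite ?addr0 ?add0r//;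
   try (by subst; rewrite ?g0 ?g0' ?g0''); by exfalso; clear -ab bc ac; subst; lia.
have sI : \sum_(t in incr3 m) g t.1.1 t.1.2 t.2 = \sum_a \sum_b \sum_c I a b c.
  rewrite pair_big pair_big /= big_mkcond /=; apply: eq_bigr => -[[a b] c] _.
  by rewrite inE.
under eq_bigr do under eq_bigr do under eq_bigr do rewrite gI.
under eq_bigr do under eq_bigr do rewrite !big_split.
under eq_bigr do rewrite !big_split.
rewrite !big_split sI /=.
set s := (X in X + _ + _ + _ + _ + _ = _).
by rewrite (sum3_132 I) (sum3_213 I) (sum3_231 I) (sum3_312 I) (sum3_321 I) -/s; ring.
Qed.

(** The length of [N /\ q] for each column [q] of [Y].  Summed over all triples of
    indices, the square of a coordinate of [N /\ q] expands into three square terms,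
    each giving [|N|^2 |q|^2], and three cross terms, each giving [- 2 |N q|^2] as
    [N] is skew-symmetric.  The coordinates proper are those of increasing triples,
    hence a factor 6.  For a unit 2-vector, [|N|^2 = 2] and the result is
    [|q|^2 - |N q|^2], the squared length of the normal part of [q]. *)
Lemma frob_dot2 N k (Y : 'M[R]_(m, k)) : N^T = - N ->
  2 * frob (dot2 N Y) ^+ 2 = frob N ^+ 2 * frob Y ^+ 2 - 2 * frob (N *m Y) ^+ 2.
Proof.
move=> skew; have Ns a b : N b a = - N a b.
  by have /matrixP/(_ a b) := skew; rewrite !mxE.
pose T a b c j := N a b * Y c j + N b c * Y a j + N c a * Y b j.
pose g a b c := \sum_j T a b c j ^+ 2.
have -> : frob (dot2 N Y) ^+ 2 = \sum_(t in incr3 m) g t.1.1 t.1.2 t.2.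
  rewrite frob_sqr [RHS]big_enum_val /=; apply: eq_bigr => r _.
  apply: eq_bigr => j _; rewrite mxE /T.
  by case: (enum_val r) => -[a b] c.
have := @sum_incr3 g _ _ _; set s := \sum_(t in _) _.
suff -> : \sum_a \sum_b \sum_c g a b c =
   3 * (frob N ^+ 2 * frob Y ^+ 2) - 6 * frob (N *m Y) ^+ 2.
  move=> H; suff: 3 * (frob N ^+ 2 * frob Y ^+ 2) - 6 * frob (N *m Y) ^+ 2 = 6 * s by lra.
  apply: H.
  - move=> a b c; apply: eq_bigr => j _; rewrite /T (Ns a b) (Ns b c) (Ns c a); ring.
  - move=> a b c; apply: eq_bigr => j _; rewrite /T (Ns a b) (Ns b c) (Ns c a); ring.
  - move=> a c; apply: big1 => j _; rewrite /T (Ns c a).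
    have -> : N a a = 0 by have := Ns a a; lra.
    by ring.
clear s; pose F (a b c : 'I_m) := \sum_j N a b ^+ 2 * Y c j ^+ 2.
pose H (a b c : 'I_m) := \sum_j (N a b * Y b j) * (N a c * Y c j).
have gE a b c : g a b c = F a b c + F b c a + F c a b - 2 * (H b a c + H c b a + H a b c).
  rewrite /g /F /H -!big_split mulr_sumr -sumrB; apply: eq_bigr => j _ /=.
  rewrite /T (Ns a b) (Ns b c) (Ns c a); ring.
have sF : \sum_a \sum_b \sum_c F a b c = frob N ^+ 2 * frob Y ^+ 2.
  rewrite !frob_sqr mulr_suml; apply: eq_bigr => a _.
  rewrite mulr_suml; apply: eq_bigr => b _; rewrite mulr_sumr; apply: eq_bigr => c _.
  by rewrite mulr_sumr.
have sH : \sum_a \sum_b \sum_c H a b c = frob (N *m Y) ^+ 2.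
  rewrite frob_sqr; apply: eq_bigr => a _.
  under eq_bigr do rewrite exchange_big.
  rewrite exchange_big; apply: eq_bigr => j _ /=.
  rewrite mxE expr2 mulr_suml; apply: eq_bigr => b _.
  by rewrite mulr_sumr.
under eq_bigr do under eq_bigr do under eq_bigr do rewrite gE.
under eq_bigr do under eq_bigr do rewrite sumrB -mulr_sumr !big_split.
under eq_bigr do rewrite sumrB -mulr_sumr !big_split.
rewrite sumrB -mulr_sumr !big_split /=.
by rewrite (sum3_231 F) (sum3_312 F) (sum3_213 H) (sum3_321 H) sF sH; ring.
Qed.


End TrianglePlane.

(** * Projection onto the plane of a triangle *)

Section NormDefect.
Context {R : realType} {m : nat}.

Lemma norm2_bound_mx p q k (A : 'M[R]_(p, q)) (B : 'M[R]_(q, k)) :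
  frob (A *m B) <= norm2 A * frob B.
Proof.
rewrite -ler_sqr ?nnegrE ?mulr_ge0 ?frob_ge0 ?norm2_ge0// exprMn.
have colE r (C : 'M[R]_(r, k)) : frob C ^+ 2 = \sum_j frob (col j C) ^+ 2.
  rewrite frob_sqr exchange_big; apply: eq_bigr => j _; rewrite frob_sqr.
  by apply: eq_bigr => i _; rewrite big_ord1 mxE.
rewrite !colE mulr_sumr; apply: ler_sum => j _.
rewrite -exprMn ler_sqr ?nnegrE ?mulr_ge0 ?frob_ge0 ?norm2_ge0//.
have -> : col j (A *m B) = A *m col j B.
  by apply/colP => i; rewrite !mxE; apply: eq_bigr => l _; rewrite !mxE.
exact: norm2_bound.
Qed.

Lemma frob_mul_isometry p q k (G : 'M[R]_(p, q)) (Q : 'M[R]_(k, q)) :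
  Q^T *m Q = 1%:M -> frob (G *m Q^T) = frob G.
Proof.
move=> QQ; apply/eqP; rewrite -(eqrXn2 (n := 2)) ?frob_ge0// !frob_sqr_tr.
by rewrite trmx_mul trmxK !mulmxA -(mulmxA G) QQ mulmx1.
Qed.

Lemma dot2_mulmx k l (N : 'M[R]_m) (Q : 'M[R]_(m, k)) (B : 'M[R]_(k, l)) :
  dot2 N (Q *m B) = dot2 N Q *m B.
Proof.
apply/matrixP => r j; rewrite !mxE; under [RHS]eq_bigr do rewrite mxE.
case: (enum_val r) => -[a b] c; rewrite !mxE !mulr_sumr -!big_split.
by apply: eq_bigr => i _ /=; ring.
Qed.

(** The hypotheses are the algebraic description of a unit simple 2-vector. *)
Variable N : 'M[R]_m.
Hypotheses (skewN : N^T = - N) (N3 : N *m (N *m N) = - N) (N2 : frob N ^+ 2 = 2).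

(** [N N^T] is a symmetric idempotent, so the squared norm of [X (N N^T)] is the
    trace of [X (N N^T) X^T]. *)
Lemma frob_proj n (X : 'M[R]_(n, m)) :
  frob (X *m (N *m N^T)) = frob (N *m X^T).
Proof.
apply/eqP; rewrite -(eqrXn2 (n := 2)) ?frob_ge0// -[frob (N *m _)]frob_trmx.
rewrite !frob_sqr_tr !trmx_mul !trmxK !skewN.
have N3X (Z : 'M[R]_(m, n)) : N *m (N *m (N *m Z)) = - (N *m Z).
  by rewrite -mulNmx -N3 !mulmxA.
by rewrite !(mulNmx, mulmxN, opprK) -!mulmxA N3X !(mulNmx, mulmxN, opprK).
Qed.

(** With [P] the projection onto the plane of [N], the squared defect
    [|X|^2 - |X P|^2] is at most [s^2 |X|^2], [s] being the size of the normal
    part of the columns of [Q].  Dividing by [|X| + |X P| >= |X|] makes the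
    defect of the norms themselves quadratic in [s]. *)
Lemma norm_defect_proj n k (G : 'M[R]_(n, k)) (Q : 'M[R]_(m, k))
    (X := G *m Q^T) : Q^T *m Q = 1%:M ->
  `|frob X - frob (X *m (N *m N^T))| <= frob X * norm2 (dot2 N Q) ^+ 2.
Proof.
move=> QQ; rewrite frob_proj.
have XG : frob X = frob G by rewrite /X frob_mul_isometry.
have := frob_dot2 X^T skewN; rewrite N2 frob_trmx.
have : frob (dot2 N X^T) ^+ 2 <= norm2 (dot2 N Q) ^+ 2 * frob X ^+ 2.
  rewrite -exprMn ler_sqr ?nnegrE ?mulr_ge0 ?frob_ge0 ?norm2_ge0//.
  rewrite /X trmx_mul trmxK dot2_mulmx -/X XG -[frob G]frob_trmx.
  exact: norm2_bound_mx.
have := frob_ge0 (N *m X^T); have := frob_ge0 X; have := sqr_ge0 (frob (dot2 N X^T)).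
move: (frob X) (frob (N *m X^T)) (norm2 _ ^+ 2) (frob _ ^+ 2) => a c s d d0 a0 c0 ds E.
have ca : c <= a by rewrite -ler_sqr ?nnegrE//; lra.
rewrite ger0_norm ?subr_ge0//; have [->|an0] := eqVneq a 0; first lra.
have apos : 0 < a by rewrite lt0r an0.
(* [a (a - c) <= (a + c) (a - c) = d <= s a^2] *)
by rewrite -(ler_pM2l apos); nra.
Qed.

End NormDefect.

Section TriangleFrame.
Context {R : realType} {m : nat} (vi vj vk : 'cV[R]_m).
Hypothesis area_gt0 : 0 < area vi vj vk.
Let N := normal2 vi vj vk.

Let D := dotv (vi - vj) (vi - vj) * dotv (vj - vk) (vj - vk)
         - dotv (vi - vj) (vj - vk) ^+ 2.

Let sq2A : (2 * area vi vj vk) ^+ 2 = D.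
Proof.
rewrite /area -/D mulrC divfK//; rewrite sqr_sqrtr// ltW//.
by move: area_gt0; rewrite /area -/D pmulr_lgt0 ?invr_gt0// sqrtr_gt0.
Qed.

Let A2n0 : 2 * area vi vj vk != 0.
Proof. by rewrite mulf_neq0// gt_eqF. Qed.

Lemma tr_normal2 : N^T = - N.
Proof. by rewrite /N /normal2 linearZ /= tr_extmul scalerN. Qed.

Lemma normal2_cube : N *m (N *m N) = - N.
Proof.
rewrite /N /normal2 -!(scalemxAl, scalemxAr) extmul_cube !scalerA -[RHS]scaleNr.
congr (_ *: _); have -> : dotv (vi - vj) (vj - vk) ^+ 2
  - dotv (vi - vj) (vi - vj) * dotv (vj - vk) (vj - vk) = - D by rewrite opprB.
by rewrite -sq2A; move: A2n0; move: (2 * area _ _ _) => d d0; field.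
Qed.

Lemma frob_normal2 : frob N ^+ 2 = 2.
Proof.
rewrite /N /normal2 frobZ exprMn extmul_frob -/D -sq2A real_normK ?num_real//.
by move: A2n0; move: (2 * area _ _ _) => d d0; field.
Qed.

Lemma mul_cols3 p q (a b c : 'cV[R]_p) (a' b' c' : 'cV[R]_q) :
  cols3 a b c *m (cols3 a' b' c')^T = a *m a'^T + b *m b'^T + c *m c'^T.
Proof.
rewrite /cols3 (@tr_row_mx _ q 1 2) (@tr_row_mx _ q 1 1) (@mul_row_col _ p 1 2).
by rewrite (@mul_row_col _ p 1 1) addrA.
Qed.

Lemma mul_bmx n (a b c : 'cV[R]_n) : cols3 a b c *m (bmx vi vj vk)^T =
  (2 * area vi vj vk)^-1 *:
   ((a *m (vj - vk)^T + b *m (vk - vi)^T + c *m (vi - vj)^T) *m N^T).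
Proof.
rewrite /bmx linearZ /= -scalemxAr mul_cols3 -/N /mulv2; congr (_ *: _).
by rewrite !trmx_mul !mulmxA -!mulmxDl.
Qed.

(** The edges of the triangle sum to zero. *)
Lemma mul_bmx_const n (a : 'cV[R]_n) : cols3 a a a *m (bmx vi vj vk)^T = 0.
Proof.
rewrite mul_bmx -!mulmxDr -!linearD /=.
have -> : vj - vk + (vk - vi) + (vi - vj) = 0 by apply/colP => i; rewrite !mxE; ring.
by rewrite linear0 mulmx0 mul0mx scaler0.
Qed.

(** Barycentric coordinates reproduce affine maps.  The reason is that
    [v_i v_jk^T + v_j v_ki^T + v_k v_ij^T] does not depend on the origin and is the
    exterior product [v_ij /\ v_jk]. *)
Lemma mul_bmx_vertices : cols3 vi vj vk *m (bmx vi vj vk)^T = N *m N^T.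
Proof.
rewrite mul_bmx scalemxAl; congr (_ *m _); rewrite /N /normal2 /extmul.
congr (_ *: _).
have -> : vk - vi = - (vi - vj) - (vj - vk) by apply/colP => i; rewrite !mxE; ring.
rewrite !linearB !linearN /= !(mulmxBr, mulmxN, mulmxBl).
by apply/matrixP => i j; rewrite !(mxE, big_ord1); ring.
Qed.

End TriangleFrame.

(** * Square roots of positive definite matrices of order two *)

Section TwoByTwo.
Context {R : realType}.
Implicit Types (A G S : 'M[R]_2).

Lemma sum_ord2 (F : 'I_2 -> R) : \sum_i F i = F 0 + F 1.
Proof. by rewrite !big_ord_recl big_ord0 addr0; congr (_ + F _); exact/val_inj. Qed.

Lemma ord2P (i : 'I_2) : i = 0 \/ i = 1.
Proof. by case: i => [[|[|]]]//= ?; [left|right]; exact/val_inj. Qed.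

Lemma det2E A : \det A = A 0 0 * A 1 1 - A 0 1 * A 1 0.
Proof.
rewrite (expand_det_row _ 0) sum_ord2 /cofactor !det_mx11 !mxE /= expr0 expr1 mul1r.
rewrite mulN1r mulrN; congr (_ * A _ _ - _ * A _ _); exact/val_inj.
Qed.

Lemma posdef_entries S : posdefmx S ->
  [/\ S 1 0 = S 0 1, 0 < S 0 0, 0 < S 1 1 & 0 < S 0 0 * S 1 1 - S 0 1 ^+ 2].
Proof.
move=> [symS pS]; have s10 : S 1 0 = S 0 1.
  by have /matrixP/(_ 0 1) := symS; rewrite mxE.
have form (y : 'cV[R]_2) : (y^T *m S *m y) 0 0 =
    S 0 0 * y 0 0 ^+ 2 + 2 * S 0 1 * y 0 0 * y 1 0 + S 1 1 * y 1 0 ^+ 2.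
  by rewrite !(mxE, sum_ord2) s10; ring.
have pos (a b : R) : (a != 0) || (b != 0) ->
    0 < S 0 0 * a ^+ 2 + 2 * S 0 1 * a * b + S 1 1 * b ^+ 2.
  move=> ab0; have := pS (\col_i if i == 0 then a else b).
  rewrite form !mxE /=; apply; apply/eqP => /colP y0.
  by move: ab0 (y0 0) (y0 1); rewrite !mxE /= => /orP[] /eqP.
have p0 : 0 < S 0 0 by have := pos 1 0; rewrite oner_eq0 /= => /(_ isT); lra.
have p1 : 0 < S 1 1 by have := pos 0 1; rewrite oner_eq0 orbT => /(_ isT); lra.
(* at this vector the form takes the value [S 0 0 * \det S] *)
split=> //; have := pos (S 0 1) (- S 0 0); rewrite oppr_eq0 (gt_eqF p0) orbT => /(_ isT) H.
by rewrite -(pmulr_rgt0 _ p0); move: H; congr (_ < _); ring.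
Qed.

(** Sylvester's criterion, by completing the square. *)
Lemma posdef_of_entries S : S 1 0 = S 0 1 -> 0 < S 0 0 ->
  0 < S 0 0 * S 1 1 - S 0 1 ^+ 2 -> posdefmx S.
Proof.
move=> s10 p0 pd; split.
  apply/matrixP => i j; rewrite mxE.
  by case: (ord2P i) => ->; case: (ord2P j) => ->; rewrite ?s10.
move=> y yn0; rewrite -(pmulr_rgt0 _ p0).
have -> : S 0 0 * (y^T *m S *m y) 0 0 =
    (S 0 0 * y 0 0 + S 0 1 * y 1 0) ^+ 2 + (S 0 0 * S 1 1 - S 0 1 ^+ 2) * y 1 0 ^+ 2.
  by rewrite !(mxE, sum_ord2) s10; ring.
have q0 : 0 <= (S 0 0 * S 1 1 - S 0 1 ^+ 2) * y 1 0 ^+ 2 by rewrite mulr_ge0 ?sqr_ge0 ?ltW.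
rewrite lt0r addr_ge0 ?sqr_ge0// andbT.
rewrite paddr_eq0 ?sqr_ge0// sqrf_eq0 mulf_eq0 (gt_eqF pd) /= sqrf_eq0.
apply: contra yn0 => /andP[/eqP h0 /eqP h1]; apply/eqP/colP => i.
move: h0; rewrite h1 mulr0 addr0 => /eqP; rewrite mulf_eq0 (gt_eqF p0) /= => /eqP h0.
by rewrite mxE; case: (ord2P i) => ->.
Qed.

(** By Cayley-Hamilton a square root [S] of a [2 x 2] matrix [G] satisfies
    [(\tr S) S = G + (\det S) I], and for positive definite [S] its trace and
    determinant are determined by those of [G]. *)
Definition sqrtmx2 G : 'M[R]_2 :=
  (Num.sqrt (\tr G + 2 * Num.sqrt (\det G)))^-1 *: (G + (Num.sqrt (\det G))%:M).

Lemma sqrtmx2P G : posdefmx G -> posdefmx (sqrtmx2 G) /\ sqrtmx2 G *m sqrtmx2 G = G.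
Proof.
move=> pG; have [g10 g0 g1 gd] := posdef_entries pG.
have trE : \tr G = G 0 0 + G 1 1 by rewrite /mxtrace sum_ord2.
have dE : \det G = G 0 0 * G 1 1 - G 0 1 ^+ 2 by rewrite det2E g10 expr2.
rewrite /sqrtmx2; set d := Num.sqrt (\det G); set t := Num.sqrt _.
have d0 : 0 < d by rewrite sqrtr_gt0 dE.
have d2 : d ^+ 2 = G 0 0 * G 1 1 - G 0 1 ^+ 2 by rewrite sqr_sqrtr ?dE ?ltW.
have t2 : t ^+ 2 = G 0 0 + G 1 1 + 2 * d.
  by rewrite sqr_sqrtr trE// !addr_ge0 ?mulr_ge0 ?ltW.
have t0 : 0 < t by rewrite sqrtr_gt0 trE !addr_gt0 ?mulr_gt0.
have tn0 : t != 0 by rewrite gt_eqF.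
have ti : t^-1 ^+ 2 * (G 0 0 + G 1 1 + 2 * d) = 1.
  by rewrite -t2 exprVn mulVf// sqrf_eq0.
split.
  apply: posdef_of_entries; rewrite !mxE /= ?mulr1n ?mulr0n ?addr0 ?g10//.
    by rewrite mulr_gt0 ?invr_gt0 ?addr_gt0.
  have -> : t^-1 * (G 0 0 + d) * (t^-1 * (G 1 1 + d)) - (t^-1 * G 0 1) ^+ 2
     = d * (t^-1 ^+ 2 * (G 0 0 + G 1 1 + 2 * d)).
    apply/eqP; rewrite -subr_eq0; apply/eqP.
    transitivity (t^-1 ^+ 2 * (G 0 0 * G 1 1 - G 0 1 ^+ 2 - d ^+ 2)); first by ring.
    by rewrite d2 subrr mulr0.
  by rewrite ti mulr1.
rewrite -scalemxAl -scalemxAr scalerA.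
have -> : (G + d%:M) *m (G + d%:M) = t ^+ 2 *: G.
  rewrite t2; apply/matrixP => i j.
  by case: (ord2P i) => ->; case: (ord2P j) => ->;
    rewrite !(mxE, sum_ord2) /= ?mulr1n ?mulr0n ?addr0 ?g10; lra.
by rewrite scalerA -invfM -expr2 mulVf ?scale1r// sqrf_eq0.
Qed.

(** The trace and the determinant of a positive definite root [S] are positive, and
    [\det G = (\det S)^2], [\tr G = (\tr S)^2 - 2 \det S] determine them. *)
Lemma sqrtmxE G : posdefmx G -> sqrtmx G = sqrtmx2 G.
Proof.
move=> pG; apply: (xget_unique _ (sqrtmx2P pG)) => S [pS SS].
have [s10 s0 s1 sd] := posdef_entries pS.
have dE : Num.sqrt (\det G) = \det S.
  by rewrite -SS det_mulmx -expr2 sqrtr_sqr ger0_norm// det2E s10 -expr2 ltW.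
have tE : Num.sqrt (\tr G + 2 * \det S) = \tr S.
  have -> : \tr G + 2 * \det S = (\tr S) ^+ 2.
    rewrite -SS /mxtrace !sum_ord2 !mxE !sum_ord2 det2E; ring.
  by rewrite sqrtr_sqr ger0_norm// /mxtrace sum_ord2 ltW// addr_gt0.
rewrite /sqrtmx2 dE tE -[LHS]scale1r -(@mulVf _ (\tr S)); last first.
  by rewrite /mxtrace sum_ord2 gt_eqF// addr_gt0.
rewrite -scalerA -SS; congr (_ *: _); apply/matrixP => i j.
rewrite !(mxE, sum_ord2) det2E /mxtrace sum_ord2.
by case: (ord2P i) => ->; case: (ord2P j) => -> /=; rewrite ?mulr1n ?mulr0n; ring.
Qed.

Lemma frob_eq0 p q (A : 'M[R]_(p, q)) : frob A = 0 -> A = 0.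
Proof.
move=> A0; apply/matrixP => i j; apply/eqP; rewrite mxE -normr_le0 -A0.
exact: ler_entry_frob.
Qed.

Lemma posdef_unit S : posdefmx S -> S \in unitmx.
Proof.
move=> /posdef_entries[s10 _ _ sd]; rewrite unitmxE det2E s10 -expr2.
by rewrite unitfE gt_eqF.
Qed.

Section Gram.
Context {m : nat} (A : 'M[R]_(m, 2)).
Hypothesis rkA : \rank A = 2%N.

Lemma posdef_gram : posdefmx (A^T *m A).
Proof.
split; first by rewrite trmx_mul trmxK.
move=> y yn0; have -> : (y^T *m (A^T *m A) *m y) 0 0 = frob (A *m y) ^+ 2.
  by rewrite -frob_trmx frob_sqr_tr trace_mx11 !trmx_mul !trmxK !mulmxA.
rewrite exprn_gt0// lt0r frob_ge0 andbT; apply: contra yn0 => /eqP/frob_eq0 Ay0.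
have free : row_free A^T by rewrite /row_free mxrank_tr rkA.
rewrite -trmx_eq0 -(mulmx_free_eq0 _ free) -trmx_mul Ay0 linear0; exact: eqxx.
Qed.

Let S := sqrtmx (A^T *m A).

Lemma sqrt_gramP : posdefmx S /\ S *m S = A^T *m A.
Proof. by rewrite /S sqrtmxE; [exact: sqrtmx2P posdef_gram|exact: posdef_gram]. Qed.

(** Polar decomposition: [A (A^T A)^(-1/2)] has orthonormal columns. *)
Lemma polar_orthonormal (Q := A *m invmx S) : Q^T *m Q = 1%:M.
Proof.
have [pS SS] := sqrt_gramP; have uS := posdef_unit pS.
rewrite /Q trmx_mul trmx_inv pS.1 -mulmxA (mulmxA A^T) -SS !mulmxA.
by rewrite mulVmx// mul1mx mulmxV.
Qed.

Lemma polar_tangent n (J : 'M[R]_(n, 2)) (Q := A *m invmx S) :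
  J *m invmx (A^T *m A) *m A^T = (J *m invmx S) *m Q^T.
Proof.
have [pS SS] := sqrt_gramP; have uS := posdef_unit pS.
rewrite /Q trmx_mul trmx_inv pS.1 !mulmxA; congr (_ *m _).
rewrite -!mulmxA; congr (_ *m _); rewrite -SS.
have uSS : S *m S \in unitmx by rewrite unitmx_mul uS.
by rewrite -[RHS]mulmx1 -(mulmxV uSS) !mulmxA mulmxKV// mulVmx// mul1mx.
Qed.

End Gram.
End TwoByTwo.

(** * The pointwise bound *)

Section PointwiseBound.
Context {R : realType} {m n N : nat} (Omega : set (R * R))
  (x : R * R -> 'cV[R]_m) (omega : 'I_N -> R * R) (f : 'cV[R]_m -> 'cV[R]_n).
Implicit Types t : 'I_N * 'I_N * 'I_N.

(** The integrand [psi] with the formula of one triangle used everywhere: unlike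
    [psi], which jumps across the edges, it is continuous. *)
Definition psi_on t w : R :=
  frob (thmx Omega x omega f t w *m (tbmx x omega t)^T)
  + frob (tgrad Omega x f w) * norm2 (dot2 (tnormal x omega t) (Qmx x w)) ^+ 2.

Lemma cols3_affine p q (M : 'M[R]_(p, q)) (a b c d : 'cV[R]_p) (u v w : 'cV[R]_q) :
  cols3 (a + d - M *m u) (b + d - M *m v) (c + d - M *m w) =
  cols3 a b c + cols3 d d d - M *m cols3 u v w.
Proof.
rewrite /cols3 (@mul_mx_row _ p q 1 2) (@mul_mx_row _ p q 1 1).
rewrite (@opp_row_mx _ p 1 2) (@opp_row_mx _ p 1 1) !(@add_row_mx _ p 1 2).
by rewrite !(@add_row_mx _ p 1 1).
Qed.

Lemma thmx_bmx t w : 0 < tarea x omega t ->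
  thmx Omega x omega f t w *m (tbmx x omega t)^T =
  tfmx x omega f t *m (tbmx x omega t)^T
  - tgrad Omega x f w *m (tnormal x omega t *m (tnormal x omega t)^T).
Proof.
move=> A0; rewrite /tnormal -mul_bmx_vertices -/(tbmx x omega t) mulmxA.
rewrite /thmx /hvec; set T := tgrad Omega x f w.
have E l : f (vtx x omega l) - f (x w) + T *m (x w - vtx x omega l) =
    f (vtx x omega l) + (T *m x w - f (x w)) - T *m vtx x omega l.
  by rewrite mulmxBr !addrA; congr (_ - _); rewrite -!addrA; congr (_ + _); rewrite addrC.
rewrite !E cols3_affine mulmxBl mulmxDl mul_bmx_const addr0.
by rewrite -/(tfmx x omega f t).
Qed.

Lemma psi_on_ge0 t w : 0 <= psi_on t w.
Proof.
apply: addr_ge0; first exact: frob_ge0.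
by apply: mulr_ge0; [exact: frob_ge0|exact: sqr_ge0].
Qed.

(** With [P] the projection onto the plane of the triangle, [f b^T] differs from
    [h b^T] by [(\nabla f) P], so that the first summand of [psi] bounds the
    distance of [|f b^T|] to [|(\nabla f) P|] and the second one the distance of
    the latter to [|\nabla f|]. *)
Lemma dist_frob_le_psi t w : \rank (grad x w) = 2%N -> 0 < tarea x omega t ->
  `|frob (tgrad Omega x f w) - frob (tfmx x omega f t *m (tbmx x omega t)^T)|
  <= psi_on t w.
Proof.
move=> rk A0; rewrite /psi_on thmx_bmx//.
set Y := tfmx _ _ _ _ *m _; set X := tgrad _ _ _ _; set P := tnormal _ _ _ *m _.
apply: le_trans (ler_distD (frob (X *m P)) _ _) _; rewrite addrC; apply: lerD.
  by rewrite distrC; exact: ler_dist_frob.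
have XE : X = (jacobian_on Omega (f \o x) w *m invmx (sqrtmx (gram x w))) *m (Qmx x w)^T.
  exact: (polar_tangent rk).
rewrite XE; apply: (norm_defect_proj (tr_normal2 _ _ _) (normal2_cube A0)
  (frob_normal2 A0)).
exact: polar_orthonormal.
Qed.

End PointwiseBound.

(** * Continuity relative to a set *)

Section WithinContinuity.
Context {R : realType} {T : topologicalType} (D : set T).
Implicit Types (g h : T -> R).

Lemma within_cst (c : R) : {within D, continuous (fun=> c)}.
Proof. by move=> w; exact: cvg_cst. Qed.

Lemma withinD g h : {within D, continuous g} -> {within D, continuous h} ->
  {within D, continuous (fun w => g w + h w)}.
Proof. by move=> cg ch w; apply: cvgD; [exact: cg|exact: ch]. Qed.

Lemma withinN g : {within D, continuous g} -> {within D, continuous (fun w => - g w)}.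
Proof. by move=> cg w; apply: cvgN; exact: cg. Qed.

Lemma withinM g h : {within D, continuous g} -> {within D, continuous h} ->
  {within D, continuous (fun w => g w * h w)}.
Proof. by move=> cg ch w; apply: cvgM; [exact: cg|exact: ch]. Qed.

Lemma withinX2 g : {within D, continuous g} -> {within D, continuous (fun w => g w ^+ 2)}.
Proof. by move=> cg; under eq_fun do rewrite expr2; exact: withinM. Qed.

Lemma withinV g : (forall w, D w -> g w != 0) -> {within D, continuous g} ->
  {within D, continuous (fun w => (g w)^-1)}.
Proof.
move=> gn0 /subspace_continuousP cg; apply/subspace_continuousP => w Dw.
by apply: cvgV; [exact: gn0|exact: cg].
Qed.

Lemma within_sqrt g : {within D, continuous g} ->
  {within D, continuous (fun w => Num.sqrt (g w))}.
Proof.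
by move=> cg w; apply: continuous_cvg; [exact: sqrt_continuous|exact: cg].
Qed.

Lemma within_for g : (forall w, D w -> {for w, continuous g}) -> {within D, continuous g}.
Proof.
move=> cg; apply/subspace_continuousP => w Dw; apply: cvg_within_filter; exact: cg.
Qed.

(** The bound [k w] on the oscillation at [w] need only hold near [w], as is the
    case when it comes from a first-order expansion. *)
Lemma within_squeeze g (k : T -> T -> R) :
  (forall w, D w -> k w w = 0) ->
  (forall w, D w -> {within D, continuous (k w)}) ->
  (forall w, D w -> \forall w' \near within D (nbhs w), `|g w' - g w| <= k w w') ->
  {within D, continuous g}.
Proof.
move=> k0 ck gk; apply/subspace_continuousP => w Dw.
have kw : k w w' @[w' --> within D (nbhs w)] --> 0.
  by rewrite -(k0 w Dw); have /subspace_continuousP := ck w Dw; exact.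
apply/pseudometric_normed_Zmodule.cvgrPdist_le => e e0.
move/pseudometric_normed_Zmodule.cvgrPdist_le/(_ e e0) : kw => kw.
apply: filterS2 (gk w Dw) kw => w' h; rewrite sub0r normrN distrC => h2.
exact: le_trans h (le_trans (ler_norm _) h2).
Qed.

(** Continuity is required entrywise, so that it reduces to the rules for real
    functions. *)
Definition mx_within p q (A : T -> 'M[R]_(p, q)) :=
  forall i j, {within D, continuous (fun w => A w i j)}.

Lemma mx_within_cst p q (A : 'M[R]_(p, q)) : mx_within (fun=> A).
Proof. by move=> i j; exact: within_cst. Qed.

Lemma mx_withinD p q (A B : T -> 'M[R]_(p, q)) : mx_within A -> mx_within B ->
  mx_within (fun w => A w + B w).
Proof. by move=> cA cB i j; under eq_fun do rewrite mxE; exact: withinD. Qed.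

Lemma mx_withinB p q (A B : T -> 'M[R]_(p, q)) : mx_within A -> mx_within B ->
  mx_within (fun w => A w - B w).
Proof.
by move=> cA cB i j; under eq_fun do rewrite !mxE; apply: withinD => //; exact: withinN.
Qed.

Lemma mx_withinZ p q (g : T -> R) (A : T -> 'M[R]_(p, q)) :
  {within D, continuous g} -> mx_within A -> mx_within (fun w => g w *: A w).
Proof. by move=> cg cA i j; under eq_fun do rewrite mxE; exact: withinM. Qed.

Lemma mx_within_tr p q (A : T -> 'M[R]_(p, q)) : mx_within A ->
  mx_within (fun w => (A w)^T).
Proof. by move=> cA i j; under eq_fun do rewrite mxE; exact: cA. Qed.

Lemma mx_within_scalar p (g : T -> R) : {within D, continuous g} ->
  mx_within (fun w => (g w)%:M : 'M[R]_p).
Proof.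
move=> cg i j; under eq_fun do rewrite mxE.
by case: (i == j); [exact: cg|exact: within_cst].
Qed.

Lemma mx_within_row_mx p q r (A : T -> 'M[R]_(p, q)) (B : T -> 'M[R]_(p, r)) :
  mx_within A -> mx_within B -> mx_within (fun w => row_mx (A w) (B w)).
Proof.
move=> cA cB i j; under eq_fun do rewrite mxE.
by case: (fintype.split j) => k; [exact: cA|exact: cB].
Qed.

Lemma within_sum (I : finType) (F : I -> T -> R) :
  (forall i, {within D, continuous (F i)}) ->
  {within D, continuous (fun w => \sum_i F i w)}.
Proof.
move=> cF; elim: (index_enum I) => [|i s ih].
  by under eq_fun do rewrite big_nil; exact: within_cst.
by under eq_fun do rewrite big_cons; exact: withinD.
Qed.

Lemma mx_withinM p q r (A : T -> 'M[R]_(p, q)) (B : T -> 'M[R]_(q, r)) :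
  mx_within A -> mx_within B -> mx_within (fun w => A w *m B w).
Proof.
move=> cA cB i j; under eq_fun do rewrite mxE.
by apply: within_sum => k; exact: withinM.
Qed.

Lemma within_frob p q (A : T -> 'M[R]_(p, q)) : mx_within A ->
  {within D, continuous (fun w => frob (A w))}.
Proof.
move=> cA; apply: within_sqrt; apply: within_sum => i; apply: within_sum => j.
exact: withinX2.
Qed.

Lemma within_norm2 p q (A : T -> 'M[R]_(p, q)) : mx_within A ->
  {within D, continuous (fun w => norm2 (A w))}.
Proof.
move=> cA; apply: (@within_squeeze _ (fun w w' => frob (A w' - A w))) => w Dw.
- by rewrite subrr frob0.
- by apply: within_frob; apply: mx_withinB => //; exact: mx_within_cst.
- by apply: nearW => w'; exact: ler_dist_norm2.
Qed.

Lemma within_det2 (A : T -> 'M[R]_2) : mx_within A ->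
  {within D, continuous (fun w => \det (A w))}.
Proof.
move=> cA; under eq_fun do rewrite det2E.
by apply: withinD; [|apply: withinN]; exact: withinM.
Qed.

Lemma within_tr2 (A : T -> 'M[R]_2) : mx_within A ->
  {within D, continuous (fun w => \tr (A w))}.
Proof. by move=> cA; exact: within_sum. Qed.

Lemma mx_within_eq p q (A B : T -> 'M[R]_(p, q)) :
  (forall w, D w -> A w = B w) -> mx_within A -> mx_within B.
Proof.
move=> AB cA i j; apply: (@subspace_eq_continuous _ D _ (fun w => A w i j)); last exact: cA.
by move=> w; rewrite inE => Dw; rewrite AB.
Qed.

(** [(\tr S) I - S] is the adjugate of [S]. *)
Lemma invmx2E (S : 'M[R]_2) : S \in unitmx ->
  invmx S = (\det S)^-1 *: ((\tr S)%:M - S).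
Proof.
move=> uS; have d0 : \det S != 0 by rewrite -unitfE -unitmxE.
have SE : S *m ((\tr S)%:M - S) = (\det S)%:M.
  apply/matrixP => i j; rewrite !(mxE, sum_ord2) det2E /mxtrace sum_ord2.
  by case: (ord2P i) => ->; case: (ord2P j) => -> /=; rewrite ?mulr1n ?mulr0n; ring.
apply: (can_inj (mulKmx uS)); rewrite mulmxV// -scalemxAr SE scale_scalar_mx.
by rewrite mulVf.
Qed.

Lemma mx_within_inv2 (A : T -> 'M[R]_2) : (forall w, D w -> A w \in unitmx) ->
  mx_within A -> mx_within (fun w => invmx (A w)).
Proof.
move=> uA cA.
apply: (@mx_within_eq _ _ (fun w => (\det (A w))^-1 *: ((\tr (A w))%:M - A w))).
  by move=> w /uA/invmx2E.
apply: mx_withinZ; last first.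
  by apply: mx_withinB => //; apply: mx_within_scalar; exact: within_tr2.
apply: withinV; last exact: within_det2.
by move=> w /uA; rewrite unitmxE unitfE.
Qed.

Lemma mx_within_sqrtmx (A : T -> 'M[R]_2) : (forall w, D w -> posdefmx (A w)) ->
  mx_within A -> mx_within (fun w => sqrtmx (A w)).
Proof.
move=> pA cA; apply: (@mx_within_eq _ _ (fun w => sqrtmx2 (A w))).
  by move=> w /pA/sqrtmxE.
have cd : {within D, continuous (fun w => Num.sqrt (\det (A w)))}.
  by apply: within_sqrt; exact: within_det2.
apply: mx_withinZ; last by apply: mx_withinD => //; exact: mx_within_scalar.
apply: withinV => [w /pA pw|]; last first.
  apply: within_sqrt; apply: withinD; first exact: within_tr2.
  by apply: withinM => //; exact: within_cst.
have [_ a0 a1 _] := posdef_entries pw.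
rewrite gt_eqF// sqrtr_gt0 ltr_pwDl ?mulr_ge0 ?sqrtr_ge0//.
by rewrite /mxtrace sum_ord2 addr_gt0.
Qed.

End WithinContinuity.

(** * Continuity of the integrands on the parameter domain *)

Section SurfaceContinuity.
Context {R : realType} {m n N : nat} (Omega : set (R * R))
  (x : R * R -> 'cV[R]_m) (omega : 'I_N -> R * R) (f : 'cV[R]_m -> 'cV[R]_n).
Hypotheses (hx : smooth_simple_surface Omega x) (hf : has_lipschitz_tgrad Omega x f).

Lemma mx_within_for p q (A : R * R -> 'M[R]_(p, q)) :
  (forall w, Omega w -> {for w, continuous A}) -> mx_within Omega A.
Proof.
move=> cA i j; apply: within_for => w Ow.
apply: (@continuous_comp _ _ _ A (fun M : 'M[R]_(p, q) => M i j)); first exact: cA.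
exact: coord_continuous.
Qed.

Lemma mx_within_x : mx_within Omega x.
Proof.
have [[U [_ OU] CU] _ _] := hx.
by apply: mx_within_for => w /OU; exact: (CU 0%N).
Qed.

Lemma mx_within_grad : mx_within Omega (grad x).
Proof.
have [[U [_ OU] CU] _ _] := hx.
have cD v : mx_within Omega (fun w => 'D_v x w).
  by apply: mx_within_for => w /OU Uw; have [_ /(_ w Uw)] := CU 1%N v.
exact: (mx_within_row_mx (cD _) (cD _)).
Qed.

Lemma mx_within_gram : mx_within Omega (gram x).
Proof. by apply: mx_withinM mx_within_grad; exact: mx_within_tr mx_within_grad. Qed.

Lemma rank_grad w : Omega w -> \rank (grad x w) = 2%N.
Proof. by have [_ _] := hx; exact. Qed.

Lemma mx_within_Qmx : mx_within Omega (Qmx x).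
Proof.
apply: mx_withinM; first exact: mx_within_grad.
apply: mx_within_inv2 => [w Ow|].
  by apply: posdef_unit; have [] := sqrt_gramP (rank_grad Ow).
by apply: mx_within_sqrtmx mx_within_gram => w Ow; exact: posdef_gram (rank_grad Ow).
Qed.

(** The tangential gradient is Lipschitz for the distance of the points [x w], and
    [x] is continuous. *)
Lemma mx_within_tgrad : mx_within Omega (tgrad Omega x f).
Proof.
have [_ [L HL]] := hf; move=> i j.
apply: (@within_squeeze _ _ _ _ (fun w w' => L * frob (x w' - x w))) => w Ow.
- by rewrite subrr frob0 mulr0.
- apply: withinM; first exact: within_cst.
  apply: within_frob; apply: mx_withinB; [exact: mx_within_x|exact: mx_within_cst].
- rewrite near_withinE; apply: nearW => w' Ow'.
  apply: le_trans (HL w' w Ow' Ow).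
  by have := ler_entry_frob (tgrad Omega x f w' - tgrad Omega x f w) i j; rewrite !mxE.
Qed.

Lemma mx_within_pt (w : R * R) : mx_within Omega (fun w' => pt (w' - w)).
Proof.
move=> i j; under eq_fun do rewrite mxE.
case: (i == 0).
  apply: (@withinD _ _ _ fst (fun=> - w.1)); last exact: within_cst.
  by apply: within_for => w' _; exact: cvg_fst.
apply: (@withinD _ _ _ snd (fun=> - w.2)); last exact: within_cst.
by apply: within_for => w' _; exact: cvg_snd.
Qed.

(** A map with a first-order expansion at a point is continuous there. *)
Lemma mx_within_fx : mx_within Omega (f \o x).
Proof.
have [J _] := hf; move=> i j.
pose K w := xget 0 [set J | is_jacobian_on Omega (f \o x) w J].
apply: (@within_squeeze _ _ _ _ (fun w w' => (1 + frob (K w)) * frob (pt (w' - w)))) => w Ow.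
- rewrite subrr; suff -> : pt 0 = 0 :> 'cV[R]_2 by rewrite frob0 mulr0.
  by apply/colP => k; rewrite !mxE; case: ifP.
- apply: withinM; first exact: within_cst.
  by apply: within_frob; exact: mx_within_pt.
- have [J' HJ'] := J w Ow.
  have HK : is_jacobian_on Omega (f \o x) w (K w).
    exact: (@xgetPex _ 0 [set J | is_jacobian_on Omega (f \o x) w J] (ex_intro _ J' HJ')).
  apply: filterS (HK 1 ltr01) => w'; rewrite mul1r => H.
  have := ler_entry_frob ((f \o x) w' - (f \o x) w) i j; rewrite !mxE => /le_trans; apply.
  rewrite -[X in frob X](subrK (K w *m pt (w' - w))).
  apply: le_trans (ler_frobD _ _) _; rewrite mulrDl mul1r; apply: lerD => //.
  exact: frob_mulmx.
Qed.

Lemma within_surface_element :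
  {within Omega, continuous (fun w => Num.sqrt (\det (gram x w)))}.
Proof. by apply: within_sqrt; apply: within_det2; exact: mx_within_gram. Qed.

Lemma within_frob_tgrad : {within Omega, continuous (fun w => frob (tgrad Omega x f w))}.
Proof. by apply: within_frob; exact: mx_within_tgrad. Qed.

Lemma within_psi_on t : {within Omega, continuous (psi_on Omega x omega f t)}.
Proof.
have ch l : mx_within Omega (hvec Omega x omega f l).
  apply: mx_withinD; first by apply: mx_withinB; [exact: mx_within_cst|exact: mx_within_fx].
  apply: mx_withinM; first exact: mx_within_tgrad.
  by apply: mx_withinB; [exact: mx_within_x|exact: mx_within_cst].
apply: withinD.
  apply: within_frob; apply: mx_withinM; last exact: mx_within_cst.
  by apply: (@mx_within_row_mx _ _ _ _ 1 2) => //; apply: (@mx_within_row_mx _ _ _ _ 1 1).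
apply: withinM; first exact: within_frob_tgrad.
apply: withinX2; apply: within_norm2 => r j; under eq_fun do rewrite mxE.
case: (enum_val r) => -[a b] c.
have cN (k l h : 'I_m) :
    {within Omega, continuous (fun w => tnormal x omega t k l * Qmx x w h j)}.
  by apply: withinM; [exact: within_cst|exact: mx_within_Qmx].
by apply: withinD; first apply: withinD.
Qed.

End SurfaceContinuity.

(** * Integrals over almost disjoint unions *)

Section AlmostPartition.
Context d (T : measurableType d) (R : realType) (mu : {measure set T -> \bar R})
  (I : finType) (S : {set I}) (C : I -> set T).
Hypotheses (mC : forall t, t \in S -> measurable (C t))
  (C_null : forall t t', t \in S -> t' \in S -> t != t' -> mu.-negligible (C t `&` C t')).

Let cell t : set T := [set w | [pick t in S | w \in C t] = Some t].

Lemma cell_sub t : cell t `<=` C t.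
Proof.
move=> w; rewrite /cell /=; case: pickP => //= t' /andP[_ wt'] [<-].
by rewrite inE in wt'.
Qed.

(** Which cell a point belongs to depends on the finite set of the [C t] that
    contain it, and the points with a prescribed such set are a finite
    intersection of the [C t] and of their complements. *)
Lemma measurable_cell t : measurable (cell t).
Proof.
pose E (A : {set I}) := \bigcap_(t in [set` S]) (if t \in A then C t else ~` C t).
have -> : cell t = \bigcup_(A in [set A : {set I} | [pick t in S | t \in A] = Some t]) E A.
  apply/seteqP; split => w.
    rewrite /cell /= => pw; exists [set t | w \in C t]%SET => /=.
      by rewrite -pw; apply: eq_pick => t' /=; rewrite !inE.
    move=> t' _; rewrite inE; case: ifPn => [/set_mem//|/negP wt' Ct'].
    by apply: wt'; exact/mem_set.
  move=> [A /= pA EA]; rewrite /cell /= -pA; apply: eq_pick => t' /=.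
  have [t'S|//] := boolP (t' \in S); have := EA t' t'S.
  case: ifPn => [_ /mem_set//|_ nC].
  by apply/negbTE/negP => /set_mem.
apply: fin_bigcup_measurable => [|A _].
  exact: finite_finset.
apply: fin_bigcap_measurable; first exact: finite_finset.
by move=> t' /mC mt'; case: ifP => _ //; exact: measurableC.
Qed.

(** A point of [C t] outside its cell belongs to another piece. *)
Lemma cell_null t : t \in S -> mu (C t `\` cell t) = 0%E.
Proof.
move=> tS; have m := measurableD (mC tS) (measurable_cell t).
apply/negligibleP => //.
apply: (@negligibleS _ _ _ _ (\big[setU/set0]_(t' <- enum S | t' != t) (C t `&` C t'))).
  move=> w [Ctw]; rewrite /cell /=; case: pickP => [t' /andP[t'S /set_mem Ct'w]|/(_ t)].
    have [->|t't _] := eqVneq t' t; first by move=> /(_ erefl).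
    rewrite -bigcup_seq_cond; exists t' => //=.
    by rewrite mem_enum t'S.
  by rewrite tS mem_set.
rewrite big_seq_cond; elim/big_ind: _ => [|A B|t' /andP[]]; first exact: negligible_set0.
  exact: negligibleU.
by rewrite mem_enum => t'S t't; apply: C_null => //; rewrite eq_sym.
Qed.

Lemma cell_cover : \bigcup_(t in [set` S]) C t = \big[setU/set0]_(t <- enum S) cell t.
Proof.
rewrite -bigcup_seq; apply/seteqP; split => w [t tS Cw]; last first.
  by exists t; [rewrite /= mem_enum in tS|exact: cell_sub].
have : exists t', [pick t in S | w \in C t] = Some t'.
  by case: pickP => [t' _|/(_ t)]; [exists t'|rewrite tS mem_set].
move=> [t' pt']; exists t' => //=; rewrite mem_enum.
by move: pt'; case: pickP => // t'' /andP[t''S _] [<-].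
Qed.

(** Integrals over an almost disjoint union are sums, even of a function that is
    given piecewise by the selection of one piece at every point. *)
Lemma Rintegral_pick (F : T -> R) (G : I -> T -> R) :
    (forall t, t \in S -> mu.-integrable (C t) (EFin \o G t)) ->
    (forall t w, [pick t in S | w \in C t] = Some t -> F w = G t w) ->
  \int[mu]_(w in \bigcup_(t in [set` S]) C t) F w
  = \sum_(t in S) \int[mu]_(w in C t) G t w.
Proof.
move=> iG FG; rewrite cell_cover /Rintegral integral_bigsetU_EFin; last first.
- rewrite -bigcup_seq => _ A mA; rewrite setI_bigcupl.
  apply: fin_bigcup_measurable; first exact: finite_seq.
  move=> t; rewrite /= mem_enum => tS.
  have mG : measurable_fun (cell t) (fun w => (G t w)%:E).
    apply: (measurable_funS (mC tS)); first exact: cell_sub.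
    by case/integrableP: (iG t tS).
  have : measurable_fun (cell t) (fun w => (F w)%:E).
    by apply: eq_measurable_fun mG => w; rewrite inE => /FG /= ->.
  by move=> /(_ (measurable_cell t)); exact.
- by move=> t t' _ _ [w []]; rewrite /cell /= => -> [].
- exact: enum_uniq.
- exact: measurable_cell.
have E t : t \in S ->
    (\int[mu]_(w in cell t) (F w)%:E = \int[mu]_(w in C t) (G t w)%:E)%E.
  move=> tS; rewrite (negligible_integral (measurableD (mC tS) (measurable_cell t)) (mC tS)
    (iG t tS) (cell_null tS)).
  rewrite setDD (setIidr (@cell_sub t)); apply: eq_integral => w.
  by rewrite inE => /FG ->.
rewrite big_enum_cond /= (eq_bigl (mem S)) => [|t]; last by rewrite andbT.
rewrite (eq_bigr _ E) -sum_fine// => t tS; exact: (integrable_fin_num (mC tS) (iG t tS)).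
Qed.

End AlmostPartition.

(** * From the pointwise bound to the energies *)

Section EnergyGap.
Context d (T : measurableType d) (R : realType) (mu : {measure set T -> \bar R}).

Lemma integrable_lin3 (D : set T) (f g h : T -> R) (a b c : R) : measurable D ->
    mu.-integrable D (EFin \o f) -> mu.-integrable D (EFin \o g) ->
    mu.-integrable D (EFin \o h) ->
  mu.-integrable D (EFin \o (fun w => a * f w + b * g w + c * h w)).
Proof.
move=> mD fi gi hi.
have Z r (k : T -> R) : mu.-integrable D (EFin \o k) ->
    mu.-integrable D (fun w => (r * k w)%:E).
  by move=> ki; under eq_fun do rewrite EFinM; exact: integrableZl.
rewrite /comp; under eq_fun do rewrite !EFinD.
by apply: integrableD => //; [apply: integrableD => //|]; exact: Z.
Qed.

Lemma Rintegral_lin3 (D : set T) (f g h : T -> R) (a b c : R) : measurable D ->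
    mu.-integrable D (EFin \o f) -> mu.-integrable D (EFin \o g) ->
    mu.-integrable D (EFin \o h) ->
  \int[mu]_(w in D) (a * f w + b * g w + c * h w) =
  a * \int[mu]_(w in D) f w + b * \int[mu]_(w in D) g w + c * \int[mu]_(w in D) h w.
Proof.
move=> mD fi gi hi.
have Z r (k : T -> R) : mu.-integrable D (EFin \o k) ->
    mu.-integrable D (EFin \o (fun w => r * k w)).
  by move=> ki; rewrite /comp; under eq_fun do rewrite EFinM; exact: integrableZl.
rewrite !RintegralD ?RintegralZl//; try exact: Z.
have := integrable_lin3 a b 0 mD fi gi gi; rewrite /comp.
by under eq_fun do rewrite mul0r addr0.
Qed.

Variables (I : finType) (S : {set I}) (C : I -> set T).
Hypotheses (mC : forall t, t \in S -> measurable (C t))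
  (C_null : forall t t', t \in S -> t' \in S -> t != t' -> mu.-negligible (C t `&` C t')).
Variables (a J psi : T -> R) (c : I -> R) (P : I -> T -> R).
Hypotheses (J0 : forall w, 0 <= J w) (c0 : forall t, 0 <= c t)
  (P0 : forall t w, 0 <= P t w)
  (aP : forall t w, t \in S -> C t w -> `|a w - c t| <= P t w)
  (psiP : forall t w, [pick t in S | w \in C t] = Some t -> psi w = P t w).
Hypotheses (iJ : forall t, t \in S -> mu.-integrable (C t) (EFin \o J))
  (ia : forall t, t \in S -> mu.-integrable (C t) (EFin \o (fun w => a w ^+ 2 * J w)))
  (iP : forall t, t \in S -> mu.-integrable (C t) (EFin \o (fun w => P t w * J w)))
  (iP2 : forall t, t \in S -> mu.-integrable (C t) (EFin \o (fun w => P t w ^+ 2 * J w))).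

Let W := \bigcup_(t in [set` S]) C t.
Let B := \sum_(t in S) \int[mu]_(w in C t) (c t ^+ 2 * J w).
Let M := \sum_(t in S) c t * \int[mu]_(w in C t) (P t w * J w).

Let PsiE : \int[mu]_(w in W) (psi w ^+ 2 * J w)
  = \sum_(t in S) \int[mu]_(w in C t) (P t w ^+ 2 * J w).
Proof. by apply: Rintegral_pick => // t w /psiP ->. Qed.

Let cross_ge0 : 0 <= M.
Proof.
by apply: sumr_ge0 => t _; rewrite mulr_ge0// Rintegral_ge0// => w _; rewrite mulr_ge0.
Qed.

(** The quadratic polynomial in [l] is the sum of the integrals of
    [(c t - l * P t)^2 J]. *)
Let cross_cauchy : M ^+ 2 <= B * \int[mu]_(w in W) (psi w ^+ 2 * J w).
Proof.
apply: sqr_le_of_quadratic_ge0 => [|l].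
  by apply: Rintegral_ge0 => w _; rewrite mulr_ge0 ?sqr_ge0.
rewrite PsiE /B /M !mulr_sumr -sumrB -big_split/=; apply: sumr_ge0 => t tS.
have -> : \int[mu]_(w in C t) (c t ^+ 2 * J w) -
    2 * l * (c t * \int[mu]_(w in C t) (P t w * J w)) +
    l ^+ 2 * (\int[mu]_(w in C t) (P t w ^+ 2 * J w)) =
  \int[mu]_(w in C t) (c t ^+ 2 * J w + (- (2 * l * c t)) * (P t w * J w)
                        + l ^+ 2 * (P t w ^+ 2 * J w)).
  have mCt := mC tS; have iJt := iJ tS.
  rewrite Rintegral_lin3 ?RintegralZl//; [|exact: iP|exact: iP2].
  ring.
apply: Rintegral_ge0 => w _.
have -> : c t ^+ 2 * J w + (- (2 * l * c t)) * (P t w * J w) + l ^+ 2 * (P t w ^+ 2 * J w)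
  = (c t - l * P t w) ^+ 2 * J w by ring.
by rewrite mulr_ge0 ?sqr_ge0.
Qed.

(** Pointwise, [a^2 - c^2 = (a - c)^2 + 2 c (a - c)] is at most [P^2 + 2 c P] in
    absolute value. *)
Let gap : `|\int[mu]_(w in W) (a w ^+ 2 * J w) - B|
  <= \int[mu]_(w in W) (psi w ^+ 2 * J w) + 2 * M.
Proof.
rewrite PsiE (@Rintegral_pick _ _ _ mu _ S C mC C_null _ (fun _ w => a w ^+ 2 * J w))//.
rewrite /B /M -sumrB mulr_sumr -big_split/=.
apply: le_trans (ler_norm_sum _ _ _) _; apply: ler_sum => t tS.
have mCt := mC tS; have iJt := iJ tS; have iat := ia tS.
have iPt := iP tS; have iP2t := iP2 tS.
have lin r s q := Rintegral_lin3 r s q mCt.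
rewrite ler_norml; apply/andP; split.
- suff : \int[mu]_(w in C t) (c t ^+ 2 * J w) <=
    \int[mu]_(w in C t) (1 * (a w ^+ 2 * J w) + (2 * c t) * (P t w * J w)
      + 1 * (P t w ^+ 2 * J w)) by rewrite lin//; lra.
  apply: le_Rintegral => //; [|exact: integrable_lin3|move=> w Cw].
    by rewrite /comp; under eq_fun do rewrite EFinM; exact: integrableZl.
  rewrite !mul1r mulrA -!mulrDl ler_wpM2r//.
  have := aP tS Cw; rewrite ler_norml => /andP[h1 h2]; have := c0 t.
  have := P0 t w; have := sqr_ge0 (a w - c t); nra.
- suff : \int[mu]_(w in C t) (a w ^+ 2 * J w) <=
    \int[mu]_(w in C t) (c t ^+ 2 * J w + (2 * c t) * (P t w * J w)
      + 1 * (P t w ^+ 2 * J w)) by rewrite lin// RintegralZl//; lra.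
  apply: le_Rintegral => //; [exact: integrable_lin3|move=> w Cw].
  rewrite !mul1r mulrA -!mulrDl ler_wpM2r//.
  have := aP tS Cw; rewrite ler_norml => /andP[h1 h2]; have := c0 t.
  have := P0 t w; have := sqr_ge0 (a w - c t); nra.
Qed.

(** A pointwise bound [|a - c| <= psi] on the densities, with [c] constant on each
    piece, bounds the difference of the energies. *)
Lemma energy_gap :
  `|1 / 2 * \int[mu]_(w in W) (a w ^+ 2 * J w)
    - \sum_(t in S) 1 / 2 * \int[mu]_(w in C t) (c t ^+ 2 * J w)|
  <= 1 / 2 * \int[mu]_(w in W) (psi w ^+ 2 * J w)
     + Num.sqrt (2 * (\sum_(t in S) 1 / 2 * \int[mu]_(w in C t) (c t ^+ 2 * J w))
                 * \int[mu]_(w in W) (psi w ^+ 2 * J w)).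
Proof.
rewrite -mulr_sumr -/B.
have -> : 2 * (1 / 2 * B) = B by field.
have Mle : M <= Num.sqrt (B * \int[mu]_(w in W) (psi w ^+ 2 * J w)).
  rewrite -(ger0_norm cross_ge0) -sqrtr_sqr; apply: ler_wsqrtr.
  exact: cross_cauchy.
have := gap; rewrite !ler_norml => /andP[g1 g2].
by apply/andP; split; lra.
Qed.

End EnergyGap.

(** * Lebesgue measure on the plane *)

Section PlaneMeasure.
Context {R : realType}.
Local Notation plane := (R * R)%type.
Local Notation mplane := (measurableTypeR R * measurableTypeR R)%type.
Local Notation mu := (@leb2 R).

(** The plane has a countable base of boxes, so that its open sets belong to the
    product of the Borel sigma-algebras. *)
Lemma open_plane_measurable (A : set plane) : open A -> measurable (A : set mplane).
Proof.
move=> oA.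
pose box (q : (rat * rat) * (rat * rat)) : set mplane :=
  [set` `](ratr q.1.1 : R), ratr q.1.2[] `*` [set` `](ratr q.2.1 : R), ratr q.2.2[].
have mbox q : measurable (box q) by exact: measurableX.
have -> : A = \bigcup_q (if `[< box q `<=` A >] then box q else set0).
  apply/seteqP; split => [p Ap|p [q _]]; last by case: asboolP => [sub bp|_ []]; exact: sub.
  have : nbhs p A by apply: open_nbhs_nbhs.
  move=> /nbhs_ballP[e /= e0 eA].
  have side (r : R) : exists q1 q2 : rat,
     [/\ ratr q1 < r, r < ratr q2 & forall s, s \in `](ratr q1 : R), ratr q2[ -> ball r e s].
    have /rat_in_itvoo[q1] : r - e < r by rewrite ltrBlDr ltrDl.
    rewrite in_itv /= => /andP[l1 l2].
    have /rat_in_itvoo[q2] : r < r + e by rewrite ltrDl.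
    rewrite in_itv /= => /andP[r1 r2].
    exists q1, q2; split=> // s; rewrite in_itv /= => /andP[s1 s2].
    rewrite /ball /= ltr_distlC; apply/andP.
    by split; [exact: lt_trans l1 s1|exact: lt_trans s2 r2].
  have [q1 [q2 [h1 h2 h]]] := side p.1; have [q3 [q4 [h3 h4 h']]] := side p.2.
  exists ((q1, q2), (q3, q4)) => //; case: asboolP => [_|[]].
    by split; rewrite /= in_itv /=; apply/andP; split.
  by move=> s [s1 s2]; apply: eA; split; [exact: h|exact: h'].
apply: countable_bigcupT_measurable => [|q]; first exact: countableP.
by case: ifP.
Qed.

Lemma closed_plane_measurable (A : set plane) : closed A -> measurable (A : set mplane).
Proof. by move/closed_openC/open_plane_measurable/measurableC; rewrite setCK. Qed.

Lemma within_plane_measurable (D : set mplane) (g : plane -> R) : measurable D ->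
  {within D, continuous g} -> measurable_fun D (g : mplane -> R).
Proof.
move=> mD /continuousP cf; apply: (measurability _ (RGenOpens.measurableE R)).
move=> _ [_ [a [b ->] <-]].
have /cf/open_subspaceP[V oV VD] : open (`]a, b[%classic : set R) by exact: interval_open.
rewrite setIC -VD; apply: measurableI => //; exact: open_plane_measurable.
Qed.

Let square (M : R) : set mplane := [set` `[- M, M]] `*` [set` `[- M, M]].

Let measurable_square M : measurable (square M).
Proof. exact: measurableX. Qed.

Let square_lty M : (mu (square M) < +oo)%E.
Proof.
have fin : (@lebesgue_measure R [set` `[(- M)%R, M]] < +oo)%E.
  by rewrite lebesgue_measure_itv; case: ifP => _; rewrite ?ltry.
by rewrite /leb2 /square product_measure1E// lte_mul_pinfty// ge0_fin_numE.
Qed.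

(** The vertical sections of a line are points, unless the line is vertical, in
    which case it is the product of a point and of the real line. *)
Lemma leb2_line (a b c : R) : (a != 0) || (b != 0) ->
  mu.-negligible ([set p | a * p.1 + b * p.2 = c] : set mplane).
Proof.
move=> ab0; set L := [set p | _].
have mL : measurable (L : set mplane).
  have mf : measurable_fun setT (fun p : mplane => a * p.1 + b * p.2 : R).
    by apply: measurable_funD; apply: measurable_funM.
  have -> : L = setT `&` (fun p : mplane => a * p.1 + b * p.2 : R) @^-1` [set c].
    by rewrite setTI.
  exact: mf.
apply/negligibleP => //; have [b0|bn0] := eqVneq b 0.
  have an0 : a != 0 by move: ab0; rewrite b0 eqxx orbF.
  pose V : set mplane := [set c / a] `*` setT.
  have -> : L = V.
    apply/seteqP; split => [[u v]|[u v] [/= -> _]]; rewrite /L /V /= b0 mul0r addr0.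
      by move=> <-; split => //=; rewrite mulrC mulKf.
    by rewrite mulrCA mulfV ?mulr1.
  change (leb2 V = 0%E); rewrite /leb2 /V product_measure1E//.
  transitivity (0 * @lebesgue_measure R setT)%E; last exact: mul0e.
  congr (_ * _)%E; exact: lebesgue_measure_set1.
change (leb2 (L : set mplane) = 0%E).
rewrite /leb2 /product_measure1; apply: integral0_eq => u _ /=.
suff -> : xsection L u = [set (c - a * u) / b] by exact: lebesgue_measure_set1.
apply/seteqP; split => v; rewrite /xsection /= inE /L /=.
  by move=> <-; rewrite addrAC subrr add0r mulrC mulKf.
by move=> ->; rewrite mulrCA mulfV// mulr1 addrC subrK.
Qed.

(** The function is bounded and the set has finite measure. *)
Lemma compact_integrable (D : set plane) (g : plane -> R) : compact D ->
  {within D, continuous g} -> mu.-integrable (D : set mplane) (EFin \o g).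
Proof.
move=> cD cg.
have mD : measurable (D : set mplane).
  by apply: closed_plane_measurable; apply: compact_closed => //; exact: norm_hausdorff.
apply: measurable_bounded_integrable => //.
- have bound (g' : plane -> R) : {within D, continuous g'} ->
      exists M : R, forall w, D w -> `|g' w| <= M.
    move=> /continuous_compact/(_ cD)/compact_bounded[M [Mr HM]].
    exists (M + 1) => w Dw; apply: HM; first by rewrite ltrDl.
    by exists w.
  have [M1 H1] : exists M : R, forall w, D w -> `|w.1| <= M.
    by apply: bound; apply: within_for => w _; exact: cvg_fst.
  have [M2 H2] : exists M : R, forall w, D w -> `|w.2| <= M.
    by apply: bound; apply: within_for => w _; exact: cvg_snd.
  apply: le_lt_trans (square_lty (Num.max M1 M2)); apply: le_measure; rewrite ?inE;
    [exact: mD|exact: measurable_square|].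
  by move=> w Dw; split; rewrite /= in_itv /= -ler_norml le_max ?H1 ?H2// orbT.
- exact: within_plane_measurable.
- have /compact_bounded[M [Mr HM]] := continuous_compact cg cD.
  by exists M; split=> // y My w Dw; apply: HM => //; exists w.
Qed.

End PlaneMeasure.

(** * Triangles in the plane *)

Section Triangles.
Context {R : realType}.
Local Notation plane := (R * R)%type.
Local Notation mplane := (measurableTypeR R * measurableTypeR R)%type.
Local Notation nondegenerate := Defs.nondegenerate.
Implicit Types a b c p : plane.

(** Twice the oriented area of the triangle. *)
Definition det_edges a b c : R := (a - b).1 * (b - c).2 - (a - b).2 * (b - c).1.

Definition barycentric a b c p : R := det_edges p b c / det_edges a b c.

Lemma det_edges_rot a b c : det_edges b c a = det_edges a b c.
Proof. by rewrite /det_edges /=; ring. Qed.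

(** Cramer's rule. *)
Lemma barycentric_combination a b c (s t u : R) : det_edges a b c != 0 ->
  s + t + u = 1 -> barycentric a b c (s *: a + t *: b + u *: c) = s.
Proof.
move=> d0 e1; have -> : u = 1 - s - t by lra.
rewrite /barycentric; apply: (mulIf d0); rewrite divfK//.
by case: a b c {d0} => [a1 a2] [b1 b2] [c1 c2]; rewrite /det_edges /= /GRing.scale /=; ring.
Qed.

Lemma triangle_barycentric a b c : nondegenerate a b c ->
  triangle a b c = [set p | [/\ 0 <= barycentric a b c p,
     0 <= barycentric b c a p & 0 <= barycentric c a b p]].
Proof.
rewrite /nondegenerate -/(det_edges a b c) => d0.
have d1 : det_edges b c a = det_edges a b c by exact: det_edges_rot.
have d2 : det_edges c a b = det_edges a b c by rewrite -det_edges_rot.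
apply/seteqP; split => [p [s [t [u [s0 t0 u0 e ->]]]]|p [h1 h2 h3]] /=.
  rewrite barycentric_combination//.
  have -> : s *: a + t *: b + u *: c = t *: b + u *: c + s *: a by rewrite [RHS]addrC addrA.
  rewrite barycentric_combination ?d1//; last by rewrite -e; ring.
  have -> : t *: b + u *: c + s *: a = u *: c + s *: a + t *: b by rewrite [RHS]addrC addrA.
  by rewrite barycentric_combination ?d2//; rewrite -e; ring.
exists (barycentric a b c p), (barycentric b c a p), (barycentric c a b p).
split=> //.
  apply: (mulIf d0); rewrite /barycentric d1 d2 !mulrDl !divfK// mul1r /det_edges /=.
  by ring.
rewrite /barycentric d1 d2; case: p {h1 h2 h3} => p1 p2.
have sc (q v : R) : q / det_edges a b c * v = q * v / det_edges a b c by rewrite mulrAC.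
by apply: injective_projections; rewrite /= /GRing.scale /=; apply: (mulIf d0);
  rewrite !sc -!mulrDl divfK// /det_edges /=; ring.
Qed.

Lemma continuous_barycentric a b c : continuous (barycentric a b c).
Proof.
have cf : continuous (fst : plane -> R) by move=> w; exact: cvg_fst.
have cs : continuous (snd : plane -> R) by move=> w; exact: cvg_snd.
move=> p; rewrite /barycentric /det_edges; apply: cvgM; last exact: cvg_cst.
by apply: cvgB; (apply: cvgM; last exact: cvg_cst);
  apply: cvgB; try exact: cvg_cst; [exact: cf|exact: cs].
Qed.

Lemma closed_triangle a b c : nondegenerate a b c -> closed (triangle a b c).
Proof.
move=> nd; rewrite triangle_barycentric//.
have cl x y z : closed [set p | 0 <= barycentric x y z p].
  by apply: (preimage_closed _ (@closed_ge R 0)) => w _; exact: continuous_barycentric.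
have := closedI (cl a b c) (closedI (cl b c a) (cl c a b)).
by congr closed; apply/seteqP; split => p /=; [move=> [? []]|move=> []].
Qed.

Lemma compact_triangle a b c : nondegenerate a b c -> compact (triangle a b c).
Proof.
move=> nd.
pose M := `|a.1| + `|a.2| + `|b.1| + `|b.2| + `|c.1| + `|c.2|.
apply: (@subclosed_compact _ _ (`[- M, M]%classic `*` `[- M, M]%classic)).
- exact: closed_triangle.
- by apply: compact_setX; exact: segment_compact.
have comb (s t u x y z : R) : 0 <= s -> 0 <= t -> 0 <= u -> s + t + u = 1 ->
    `|x| + `|y| + `|z| <= M -> s * x + t * y + u * z \in `[- M, M].
  move=> s0 t0 u0 e le; rewrite in_itv /= -ler_norml; apply: le_trans le.
  apply: le_trans (ler_normD _ _) _; apply: lerD; last first.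
    by rewrite normrM ger0_norm// ler_piMl//; lra.
  apply: le_trans (ler_normD _ _) _; apply: lerD.
    by rewrite normrM ger0_norm// ler_piMl//; lra.
  by rewrite normrM ger0_norm// ler_piMl//; lra.
move=> p [s [t [u [s0 t0 u0 e ->]]]]; split => /=; apply: comb => //; rewrite /M.
  by have := normr_ge0 a.2; have := normr_ge0 b.2; have := normr_ge0 c.2; lra.
by have := normr_ge0 a.1; have := normr_ge0 b.1; have := normr_ge0 c.1; lra.
Qed.

(** A point of a triangle outside its interior has a vanishing barycentric
    coordinate, hence lies on one of three lines. *)
Lemma triangle_boundary_negligible a b c : nondegenerate a b c ->
  (@leb2 R).-negligible (triangle a b c `\` interior (triangle a b c) : set mplane).
Proof.
move=> nd; have d0 : det_edges a b c != 0 by [].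
have op x y z : open [set p | 0 < barycentric x y z p].
  by apply: (open_comp _ (@open_gt R 0)) => w _; exact: continuous_barycentric.
have line x y z : det_edges x y z != 0 ->
    (@leb2 R).-negligible ([set p | barycentric x y z p = 0] : set mplane).
  move=> xyz0.
  apply: (negligibleS _ (@leb2_line R (y - z).2 (- (y - z).1)
      (y.1 * (y - z).2 - y.2 * (y - z).1) _)).
    move=> p /= /eqP; rewrite mulf_eq0 invr_eq0 (negbTE xyz0) orbF => /eqP.
    by rewrite /det_edges /=; lra.
  rewrite oppr_eq0 -negb_and; apply: contra xyz0 => /andP[/eqP z2 /eqP z1].
  by rewrite /det_edges z1 z2 !mulr0 subrr.
have d1 : det_edges b c a != 0 by rewrite det_edges_rot.
have d2 : det_edges c a b != 0 by rewrite -det_edges_rot.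
apply: negligibleS (negligibleU (line _ _ _ d0) (negligibleU (line _ _ _ d1) (line _ _ _ d2))).
move=> p [Tp nTp]; move: (Tp); rewrite triangle_barycentric// => -[h1 h2 h3].
have [z1|n1] := eqVneq (barycentric a b c p) 0; first by left.
have [z2|n2] := eqVneq (barycentric b c a p) 0; first by right; left.
have [z3|n3] := eqVneq (barycentric c a b p) 0; first by right; right.
exfalso; apply: nTp; rewrite /interior nbhsE /=.
exists ([set p | 0 < barycentric a b c p] `&` ([set p | 0 < barycentric b c a p] `&`
        [set p | 0 < barycentric c a b p])).
  split; first by do 2 (apply: openI => //).
  by split; [|split]; rewrite /= lt0r ?n1 ?n2 ?n3.
by rewrite triangle_barycentric// => q [/= q1 [/= q2 q3]]; split; exact: ltW.
Qed.

Lemma triangle_overlap_negligible a b c a' b' c' :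
    nondegenerate a b c -> nondegenerate a' b' c' ->
    interior (triangle a b c) `&` interior (triangle a' b' c') = set0 ->
  (@leb2 R).-negligible (triangle a b c `&` triangle a' b' c' : set mplane).
Proof.
move=> nd nd' dis.
apply: negligibleS (negligibleU (triangle_boundary_negligible nd)
                                (triangle_boundary_negligible nd')).
move=> p [Tp T'p]; have [ip|nip] := pselect (interior (triangle a b c) p); last by left.
right; split=> // ip'.
by suff : set0 p by []; rewrite -dis.
Qed.

End Triangles.

(** * The error estimate *)

Theorem theorem3p4 (R : realType) (m n N : nat) (hm : (2 <= m)%N)
    (Omega : set (R * R)) (x : R * R -> 'cV[R]_m)
    (hx : smooth_simple_surface Omega x)
    (omega : 'I_N -> R * R) (S : {set 'I_N * 'I_N * 'I_N})
    (hS : triangulation Omega omega S)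
    (hV : forall t, t \in S -> 0 < tarea x omega t)
    (f : 'cV[R]_m -> 'cV[R]_n)
    (hf : has_lipschitz_tgrad Omega x f) :
  let int_psi2 := surf_int x Omega (fun w => psi Omega x omega S f w ^+ 2) in
  `| dirichlet Omega x f - discrete_dirichlet x omega S f | <=
    1 / 2 * int_psi2
    + Num.sqrt (2 * discrete_dirichlet x omega S f * int_psi2).
Proof.
cbv zeta; have [nd OmegaE disj] := hS.
have sub t : t \in S -> tri_of omega t `<=` Omega.
  by move=> tS w Tw; rewrite OmegaE; exists t.
have int t (g : R * R -> R) : t \in S -> {within Omega, continuous g} ->
    (@leb2 R).-integrable (tri_of omega t
      : set (measurableTypeR R * measurableTypeR R)) (EFin \o g).
  move=> tS cg; apply: compact_integrable; first exact: compact_triangle (nd t tS).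
  exact: continuous_subspaceW (sub t tS) cg.
have cJ := within_surface_element hx.
have ca := within_frob_tgrad hx hf.
have cP t := @within_psi_on _ _ _ _ Omega x omega f hx hf t.
have OmegaI g : surf_int x Omega g =
    \int[@leb2 R]_(w in \bigcup_(t in [set` S]) tri_of omega t)
      (g w * Num.sqrt (\det (gram x w))) by rewrite -OmegaE.
rewrite /dirichlet /discrete_dirichlet !OmegaI /surf_int.
apply: (@energy_gap _ _ R (@leb2 R) _ S (tri_of omega) _ _
  (fun w => frob (tgrad Omega x f w)) (fun w => Num.sqrt (\det (gram x w)))
  (psi Omega x omega S f) (fun t => frob (tfmx x omega f t *m (tbmx x omega t)^T))
  (psi_on Omega x omega f)).
- move=> t tS; apply: closed_plane_measurable; exact: closed_triangle (nd t tS).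
- move=> t t' tS t'S tt'.
  by apply: triangle_overlap_negligible; [exact: nd|exact: nd|exact: disj].
- by move=> w; exact: sqrtr_ge0.
- by move=> t; exact: frob_ge0.
- by move=> t w; exact: psi_on_ge0.
- move=> t w tS Tw; apply: dist_frob_le_psi; last exact: hV.
  by apply: (rank_grad hx); exact: (sub t tS).
- by move=> t w; rewrite /psi => ->.
- by move=> t tS; exact: int.
- by move=> t tS; apply: int => //; apply: withinM => //; exact: withinX2.
- by move=> t tS; apply: int => //; exact: withinM.
- by move=> t tS; apply: int => //; apply: withinM => //; exact: withinX2.
Qed.
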